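(* Let $(\mathbf Z_N^k)_{0\le k\le N_t}$ be produced by the fully discrete Fourier--Galerkin splitting Runge--Kutta method described in the context. Suppose that the Runge--Kutta coefficients satisfy the symplectic condition $b_ia_{ij}+b_ja_{ji}=b_ib_j$ for $i,j=1,\dots,s$ and $\sum_{i=1}^sb_i=1$, that the Butcher matrix $\mathbf A=(a_{ij})$ is invertible, and that $\tau$ is sufficiently small so that the locally unique stage solution described in the context exists. Define $$\Omega_N(\mathbf Z_N)=\frac12\int_{\mathbb T_L}\mathbf d\mathbf Z_N\wedge M\mathbf d\mathbf Z_N\,dx,\qquad \mathcal K_N(\mathbf Z_N)=\frac12\,\mathbf d\mathbf Z_N\wedge K\mathbf d\mathbf Z_N.$$ Then, almost surely, $$\Omega_N(\mathbf Z_N^{k+1})-\Omega_N(\mathbf Z_N^k)+\tau\sum_{i=1}^sb_i\int_{\mathbb T_L}\partial_x\mathcal K_N(\mathbf Z_{N,i}^k)\,dx=0,\qquad k=0,1,\dots,N_t-1.$$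
   Context: $\mathbb T_L=\mathbb R/L\mathbb Z$ is identified with $[a,b)$, $L=b-a$, $\mu=2\pi/L$. Fourier coefficients: $\widehat f(k)=\frac1L\int_a^bf(x)e^{-\mathrm ik\mu(x-a)}dx$; $H_0^r$ is the zero-mean subspace of $H^r(\mathbb T_L)$. $\Lambda=(1-\partial_x^2)^{-1}$; $\partial_x^{-1}$ is the zero-mean antiderivative on zero-mean functions. $W$ is a cylindrical Wiener process on $\mathcal U=L_0^2(\mathbb T_L)$ (zero-mean $L^2$), $u_0\in H_0^\sigma(\mathbb T_L)$ is deterministic and $\Phi\in\mathcal L_2(\mathcal U;H_0^{\sigma-2}(\mathbb T_L))$ (Hilbert--Schmidt) with $\sigma>5/2$. For $N\ge1$, $S_N$ is the space of real-valued zero-mean trigonometric polynomials $\sum_{0<|k|\le N}\widehat v(k)e^{\mathrm ik\mu(x-a)}$, and $P_Nf=\sum_{0<|k|\le N}\widehat f(k)e^{\mathrm ik\mu(x-a)}$ (applied componentwise to vectors). Time grid: $\tau=T/N_t$, $t_k=k\tau$, $\Delta W_k=W(t_{k+1})-W(t_k)$; $G_N=P_N\Lambda\Phi$. Write $\mathbf Z=(U,\varphi,w,v,p)^\top$ with all components in $S_N$, $S_1(\mathbf Z)=-wU-\frac12U^3-\frac12Up^2+pv$, and $$M=\begin{bmatrix}0&\frac12&0&0&-\frac12\\-\frac12&0&0&0&0\\0&0&0&0&0\\0&0&0&0&0\\\frac12&0&0&0&0\end{bmatrix},\quad K=\begin{bmatrix}0&0&0&-1&0\\0&0&1&0&0\\0&-1&0&0&0\\1&0&0&0&0\\0&0&0&0&0\end{bmatrix}.$$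 Initial state: $U_N^0=P_Nu_0$, $p_N^0=\partial_xU_N^0$, $\varphi_N^0=\partial_x^{-1}U_N^0$, $w_N^0=-P_N[\frac14(U_N^0)^2+\frac12\Lambda((U_N^0)^2+\frac12(p_N^0)^2)]$, $v_N^0=P_N(U_N^0p_N^0)+\frac12F_N(U_N^0)$, with $F_N(U)=-P_N[\frac12\partial_x(U^2)+\partial_x\Lambda(U^2+\frac12(\partial_xU)^2)]$. One step of the method: with $s$-stage Runge--Kutta coefficients $\mathbf A=(a_{ij})$, $b=(b_i)$, stage values $\mathbf Z_{N,i}^k$ and stage derivatives $\mathbf Q_{N,i}^k$ solve, for $i=1,\dots,s$, $$\mathbf Z_{N,i}^k=\mathbf Z_N^k+\tau\sum_{j=1}^sa_{ij}\mathbf Q_{N,j}^k,\qquad M\mathbf Q_{N,i}^k+K\partial_x\mathbf Z_{N,i}^k=P_N\nabla_ZS_1(\mathbf Z_{N,i}^k),$$ with the $\varphi$-components of the stages normalized to zero spatial mean; then $$\bar{\mathbf Z}_N^{k+1}=\mathbf Z_N^k+\tau\sum_{i=1}^sb_i\mathbf Q_{N,i}^k,\qquad \mathbf Z_N^{k+1}=\bar{\mathbf Z}_N^{k+1}+\mathcal B_N\Delta W_k,\qquad \mathcal B_N=(G_N,\ \partial_x^{-1}G_N,\ 0,\ 0,\ \partial_xG_N)^\top.$$ Eliminating auxiliary variables, the stage velocities satisfy $U_{N,i}^k=U_N^k+\tau\sum_ja_{ij}F_N(U_{N,j}^k)$; the locally unique stage solution is the solution of this system in $S_N^s$ near $(U_N^k,\dots,U_N^k)$,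 which exists for $\tau$ sufficiently small by the implicit function theorem. $\mathbf d$ denotes the exterior derivative with respect to the phase variables (for a fixed realization of the noise, so the increments $\Delta W_k$ do not depend on the phase variables). For vectors of one-forms, $\alpha\wedge\beta=\sum_i\alpha_i\wedge\beta_i$. *)

(* Defs.v *)
From mathcomp Require Import all_boot all_order all_algebra.
From mathcomp Require Import all_classical all_reals all_analysis.
From mathcomp Require Import complex.

Set Implicit Arguments.
Unset Strict Implicit.
Unset Printing Implicit Defensive.

Import Order.TTheory GRing.Theory Num.Theory.
Import numFieldNormedType.Exports.

Local Open Scope classical_set_scope.
Local Open Scope ring_scope.

(* Functions on the torus R / (b - a)Z are functions [R -> R]; integrals, [L^2]
   conditions and almost-everywhere statements only look at the period [[a, b]]. *)

Section Torus.
Context {R : realType} (a b : R).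
Implicit Types (f g : R -> R) (c : int -> R[i]).

Definition period : R := b - a.
Definition freq : R := 2 * pi / period.

Definition integral_T f : R := \int[lebesgue_measure]_(x in `[a, b]) f x.
Definition cintegral_T (f : R -> R[i]) : R[i] :=
  (integral_T (fun x => complex.Re (f x)) +i* integral_T (fun x => complex.Im (f x)))%C.

Definition cis (t : R) : R[i] := (cos t +i* sin t)%C.
Definition expk (k : int) (x : R) : R[i] := cis (k%:~R * freq * (x - a)).

Definition fourier f (k : int) : R[i] :=
  (period^-1)%:C%C * cintegral_T (fun x => (f x)%:C%C * expk (- k) x).

Definition trig_sum (n : nat) c (x : R) : R[i] :=
  \sum_(1 <= k < n.+1) (c k%:Z * expk k%:Z x + c (- k%:Z) * expk (- k%:Z) x).

(* The sum is real for real [f]; [Re] only changes its type. *)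
Definition PN (N : nat) f (x : R) : R := complex.Re (trig_sum N (fourier f) x).

Definition in_SN (N : nat) f : Prop :=
  exists c, forall x, (f x)%:C%C = trig_sum N c x.

(* (1 - d^2/dx^2)^-1, the Fourier multiplier with symbol (1 + (k freq)^2)^-1 *)
Definition Lambda f (x : R) : R :=
  let c k := ((1 + (k%:~R * freq) ^+ 2)^-1)%:C%C * fourier f k in
  lim ((fun n : nat => complex.Re (c 0 * expk 0 x + trig_sum n c x)) @ \oo).

(* On continuous zero-mean periodic functions the set below is a singleton. *)
Definition dx_inv f : R -> R :=
  get [set F : R -> R | (forall x : R, is_derive x 1 F (f x)) /\ fourier F 0 = 0].

Definition ae_eq_T f g : Prop :=
  {ae lebesgue_measure, forall x, x \in `[a, b] -> f x = g x}.

Definition inner_T f g : R := integral_T (fun x => f x * g x).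

Definition L20 f : Prop :=
  [/\ measurable_fun `[a, b] f,
      lebesgue_measure.-integrable `[a, b] (fun x => (f x ^+ 2)%:E)
    & fourier f 0 = 0].

Definition sobolev_sqnorm (r : R) f : \bar R :=
  \esum_(k in [set: int])
    (powR (1 + (k%:~R * freq) ^+ 2) r *
     (complex.Re (fourier f k) ^+ 2 + complex.Im (fourier f k) ^+ 2))%:E.

(* Only meant for [0 <= r], where [H^r] is a subspace of [L^2]. *)
Definition H0 (r : R) f : Prop := L20 f /\ (sobolev_sqnorm r f < +oo)%E.

Definition orthonormal_basis_L20 (e : nat -> R -> R) : Prop :=
  [/\ forall j, L20 (e j),
      forall i j, inner_T (e i) (e j) = (i == j)%:R
    & forall f, L20 f -> (forall j, inner_T f (e j) = 0) -> ae_eq_T f (cst 0)].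

(* Operators act on representatives, so linearity and well-definedness are
   required up to almost-everywhere equality. *)
Definition hilbert_schmidt (r : R) (Phi : (R -> R) -> R -> R) : Prop :=
  [/\ forall f, L20 f -> H0 r (Phi f),
      forall f g, L20 f -> L20 g -> ae_eq_T f g -> ae_eq_T (Phi f) (Phi g),
      forall (l : R) f g, L20 f -> L20 g ->
        ae_eq_T (Phi (fun x => l * f x + g x)) (fun x => l * Phi f x + Phi g x),
      exists C : R, forall f, L20 f ->
        (sobolev_sqnorm r (Phi f) <= (C * inner_T f f)%:E)%E
    & exists e, orthonormal_basis_L20 e /\
        (\sum_(0 <= j <oo) sobolev_sqnorm r (Phi (e j)) < +oo)%E].

End Torus.

Section Wiener.
Context {R : realType} (d : measure_display) (Omega : measurableType d)
  (P : probability Omega R).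

Definition mutually_independent (I : finType) (X : I -> Omega -> R) : Prop :=
  forall B : I -> set R, (forall i, measurable (B i)) ->
    fine (P [set w | forall i, B i (X i w)]) =
    \prod_(i : I) fine (P (X i @^-1` B i)).

(* A sequence of independent standard Brownian motions: jointly over the
   components [j] and over disjoint time intervals, the increments are
   independent centred Gaussians. *)
Definition independent_brownian_motions (beta : nat -> R -> Omega -> R) : Prop :=
  [/\ forall j t, 0 <= t -> measurable_fun setT (beta j t),
      forall j, {ae P, forall w, beta j 0 w = 0},
      forall j, {ae P, forall w,
        {within `[0, +oo[, continuous (fun t => beta j t w)}},
      forall j (t t' : R), 0 <= t -> t < t' ->
        forall B : set R, measurable B ->
          P ((fun w => beta j t' w - beta j t w) @^-1` B) =
          normal_prob 0 (Num.sqrt (t' - t)) B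
    & forall (J m : nat) (t : nat -> R),
        0 <= t 0%N -> (forall l, t l <= t l.+1) ->
        mutually_independent (fun (jl : 'I_J * 'I_m) w =>
          beta jl.1 (t jl.2.+1) w - beta jl.1 (t jl.2) w)].

(* W(t) = \sum_j beta_j(t) e_j *)
Definition cylindrical_wiener (a b : R)
    (e : nat -> R -> R) (beta : nat -> R -> Omega -> R) : Prop :=
  orthonormal_basis_L20 a b e /\ independent_brownian_motions beta.

End Wiener.

Section Method.
Context {R : realType} (a b : R) (N : nat).

Local Notation integral_T := (integral_T a b).
Local Notation PN := (PN a b N).
Local Notation Lambda := (Lambda a b).
Local Notation dx_inv := (dx_inv a b).

Definition iU : 'I_5 := @Ordinal 5 0 isT.
Definition iphi : 'I_5 := @Ordinal 5 1 isT.
Definition iw : 'I_5 := @Ordinal 5 2 isT.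
Definition iv : 'I_5 := @Ordinal 5 3 isT.
Definition ip : 'I_5 := @Ordinal 5 4 isT.

Definition vec5 (U phi w v p : R) : 'cV[R]_5 :=
  \col_i [:: U; phi; w; v; p]`_i.

(* A state is the vector field x |-> (U, phi, w, v, p)(x). *)
Definition state := R -> 'cV[R]_5.
Implicit Type Z : state.

Definition component Z (i : 'I_5) : R -> R := fun x => Z x i 0.
Definition in_SN5 Z : Prop := forall i, in_SN a b N (component Z i).
Definition dx Z : state := fun x => \col_i derive1 (component Z i) x.
Definition PN5 Z : state := fun x => \col_i PN (component Z i) x.

Definition mx5 (rows : seq (seq R)) : 'M[R]_5 :=
  \matrix_(i, j) (nth [::] rows i)`_j.

Definition Mmx : 'M[R]_5 := mx5
  [:: [::      0; 2^-1; 0; 0; - 2^-1];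
      [:: - 2^-1;    0; 0; 0;      0];
      [::      0;    0; 0; 0;      0];
      [::      0;    0; 0; 0;      0];
      [::   2^-1;    0; 0; 0;      0]].

Definition Kmx : 'M[R]_5 := mx5
  [:: [:: 0;  0; 0; -1; 0];
      [:: 0;  0; 1;  0; 0];
      [:: 0; -1; 0;  0; 0];
      [:: 1;  0; 0;  0; 0];
      [:: 0;  0; 0;  0; 0]].

Definition S1 (z : 'cV[R]_5) : R :=
  let U := z iU 0 in let w := z iw 0 in let v := z iv 0 in let p := z ip 0 in
  - (w * U) - 2^-1 * U ^+ 3 - 2^-1 * (U * p ^+ 2) + p * v.

Definition grad (S : 'cV[R]_5 -> R) (z : 'cV[R]_5) : 'cV[R]_5 :=
  \col_i 'D_(delta_mx i 0) S z.

Definition FN (U : R -> R) (x : R) : R :=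
  - PN (fun y => 2^-1 * derive1 (fun z => U z ^+ 2) y
                 + derive1 (Lambda (fun z => U z ^+ 2 + 2^-1 * derive1 U z ^+ 2)) y) x.

Definition init_state (U : R -> R) : state := fun x =>
  let p := derive1 U in
  vec5 (U x)
       (dx_inv U x)
       (- PN (fun y => 4^-1 * U y ^+ 2
                + 2^-1 * Lambda (fun z => U z ^+ 2 + 2^-1 * p z ^+ 2) y) x)
       (PN (fun y => U y * p y) x + 2^-1 * FN U x)
       (p x).

Definition GN (Phi : (R -> R) -> R -> R) (f : R -> R) : R -> R :=
  PN (Lambda (Phi f)).

Definition BN (Phi : (R -> R) -> R -> R) (f : R -> R) : state := fun x =>
  vec5 (GN Phi f x) (dx_inv (GN Phi f) x) 0 0 (derive1 (GN Phi f) x).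

(* B_N (W(t') - W(t)) at the realization [w], for W = \sum_j beta_j e_j: as
   [Phi] is Hilbert-Schmidt, the series converges almost surely although W(t)
   itself is not L^2-valued. *)
Definition noise_increment (T : Type) (Phi : (R -> R) -> R -> R)
    (e : nat -> R -> R) (beta : nat -> R -> T -> R) (t t' : R) (w : T) : state :=
  fun x => \col_i lim ((fun n : nat =>
    \sum_(0 <= j < n) (beta j t' w - beta j t w) * BN Phi (e j) x i 0) @ \oo).

(* Real coordinates on [S_N]: the real and imaginary parts of the Fourier
   coefficients of index 1, ..., N; those of negative index are conjugate. *)

Definition SN_fun (q : 'rV[R]_(N + N)) (x : R) : R :=
  complex.Re (\sum_(j < N)
    let z : R[i] := (q ord0 (lshift N j) +i* q ord0 (rshift N j))%C in
    (z * expk a b j.+1%:Z x + (z^*)%C * expk a b (- j.+1%:Z) x)).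

Definition SN_coord (f : R -> R) : 'rV[R]_(N + N) :=
  row_mx (\row_(j < N) complex.Re (fourier a b f j.+1%:Z))
         (\row_(j < N) complex.Im (fourier a b f j.+1%:Z)).

Context (s : nat) (A : 'M[R]_s) (bw : 'I_s -> R) (tau : R).

(* [Y] lists, by rows, the coordinates of the stage velocities. *)
Definition stage_system (q : 'rV[R]_(N + N)) (Y : 'M[R]_(s, N + N)) : Prop :=
  forall i x, SN_fun (row i Y) x =
    SN_fun q x + tau * \sum_j A i j * FN (SN_fun (row j Y)) x.

(* The locally unique stage solution near (q0, ..., q0), in the form in which
   the implicit function theorem provides it: a differentiable function [g] of
   the current velocity whose graph is the solution set in a neighbourhood. *)
Definition local_stage_solution (q0 : 'rV[R]_(N + N))
    (g : 'rV[R]_(N + N) -> 'M[R]_(s, N + N)) : Prop :=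
  exists (V : set 'rV[R]_(N + N)) (W : set 'M[R]_(s, N + N)),
    [/\ nbhs q0 V, nbhs (\matrix_(i < s) q0) W,
        forall q, V q -> differentiable g q
      & forall q, V q -> forall Y, (W Y /\ stage_system q Y) <-> Y = g q].

Definition rk_step (noise Z : state) (Zs Qs : 'I_s -> state) (Z' : state) : Prop :=
  [/\ forall i, in_SN5 (Zs i) /\ in_SN5 (Qs i),
      forall i x, Zs i x = Z x + tau *: \sum_j A i j *: Qs j x,
      forall i x, Mmx *m Qs i x + Kmx *m dx (Zs i) x =
                  PN5 (fun y => grad S1 (Zs i y)) x,
      forall i, integral_T (component (Zs i) iphi) = 0
    & forall x, Z' x = (Z x + tau *: \sum_i bw i *: Qs i x) + noise x].

(* The numerical solution for one realization of the noise, as a function of the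
   phase variable [q] (the coordinates of the initial velocity U_N^0) near the
   actual initial point [q0]; the increments [noise k] do not depend on [q]. *)
Definition rk_trajectory (Nt : nat) (noise : nat -> state)
    (q0 : 'rV[R]_(N + N))
    (Z : 'rV[R]_(N + N) -> nat -> state)
    (Zs Qs : 'rV[R]_(N + N) -> nat -> 'I_s -> state) : Prop :=
  exists g : nat -> 'rV[R]_(N + N) -> 'M[R]_(s, N + N),
    (forall k, (k < Nt)%N ->
       local_stage_solution (SN_coord (component (Z q0 k) iU)) (g k)) /\
    \forall q \near q0,
      Z q 0%N = init_state (SN_fun q) /\
      forall k, (k < Nt)%N ->
        rk_step (noise k) (Z q k) (Zs q k) (Qs q k) (Z q k.+1) /\
        forall i, component (Zs q k i) iU =
          SN_fun (row i (g k (SN_coord (component (Z q k) iU)))).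

End Method.

Section Forms.
Context {R : realType} (a b : R) (m : nat).
Local Notation phase := 'rV[R]_m.

(* Forms at a point of the phase space are given by their values on tangent
   vectors. *)
Definition vform1 := phase -> 'cV[R]_5.
Definition form2 := phase -> phase -> R.

Definition dphase (Z : phase -> state) (q0 : phase) (x : R) : vform1 :=
  fun xi => \col_i 'd (fun q => Z q x i 0 : R^o) q0 xi.

Definition wedge_prod (al be : vform1) : form2 := fun xi eta =>
  \sum_i (al xi i 0 * be eta i 0 - al eta i 0 * be xi i 0).

Definition mulform (B : 'M[R]_5) (al : vform1) : vform1 := fun xi => B *m al xi.

Definition OmegaN (Z : phase -> state) (q0 : phase) : form2 := fun xi eta =>
  2^-1 * integral_T a b (fun x =>
    wedge_prod (dphase Z q0 x) (mulform Mmx (dphase Z q0 x)) xi eta).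

Definition KN (Z : phase -> state) (q0 : phase) (x : R) : form2 := fun xi eta =>
  2^-1 * wedge_prod (dphase Z q0 x) (mulform Kmx (dphase Z q0 x)) xi eta.

End Forms.

(* Main.v *)
Require Import Defs.
From mathcomp Require Import all_boot all_order all_algebra.
From mathcomp Require Import all_classical all_reals all_analysis.
From mathcomp Require Import complex ring lra.

(* The stage derivatives are recovered from the stage values by inverting A, and
   the stage equations express phi, w, v, p through U by antidifferentiation,
   differentiation and projected products.  Hence every component of every stage
   is a trigonometric polynomial whose coefficients depend differentiably on the
   phase variable, and the equations may be differentiated in the phase variable.
   Given two variational solutions X and Y, with stage derivatives K and L, the
   symplectic condition gives, pointwise in x,
     X'.(M Y') - X.(M Y) = tau * sum_i b_i (K_i.(M Y_i) + X_i.(M L_i)),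
   in which the noise does not appear, being independent of the phase variable.
   The variational equations M L + K dx Y = P_N (Hess S_1 Y) turn the integral of
   each summand into minus that of dx (X_i.(K Y_i)): P_N is symmetric and fixes
   S_N, and Hess S_1 is symmetric, so the Hessian terms cancel. *)

Set Implicit Arguments.
Unset Strict Implicit.
Unset Printing Implicit Defensive.

Import Order.TTheory GRing.Theory Num.Theory.
Import numFieldNormedType.Exports.

Local Open Scope classical_set_scope.
Local Open Scope ring_scope.

(** * Integrals over a period *)

Section PeriodIntegral.
Context {R : realType} (a b : R).
Local Notation I := (integral_T a b).

(** The method is given as a relation, and [local_stage_solution] makes only the stage velocities
    differentiable in the phase variable. Working in coordinates on [S_N] settles the rest: there
    the x-derivative and its inverse are matrices and a projected product is bilinear, so the
    exterior derivative commutes with the former and obeys the product rule on the latter. The noise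
    is the second obstacle. It is a pointwise limit, not known beforehand to lie in [S_N], so
    membership of a state in [S_N] is read backwards, from the stages of the step that starts there.
    No step starts at the final state; the identity for one step therefore uses the new state only
    through its pointwise derivatives in the phase variable, and its integrand is continuous because
    it equals an expression in the old state and the stages. *)

Lemma continuous_fun_scale (l : R) (f : R -> R) :
  continuous f -> continuous (fun x => l * f x).
Proof.
by move=> cf x; apply: (@continuousM _ _ (cst l) f); [exact: cst_continuous|exact: cf].
Qed.

Lemma continuous_fun_add (f g : R -> R) :
  continuous f -> continuous g -> continuous (fun x => f x + g x).
Proof. by move=> cf cg x; apply: (@continuousD _ _ _ f g); [exact: cf|exact: cg]. Qed.

Lemma continuous_fun_mul (f g : R -> R) :
  continuous f -> continuous g -> continuous (fun x => f x * g x).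
Proof. by move=> cf cg x; apply: (@continuousM _ _ f g); [exact: cf|exact: cg]. Qed.

Lemma continuous_integrable (f : R -> R) : continuous f ->
  lebesgue_measure.-integrable `[a, b] (EFin \o f).
Proof.
move=> cf; apply: continuous_compact_integrable; first exact: segment_compact.
exact: continuous_subspaceT.
Qed.

Lemma integral_TD (f g : R -> R) : continuous f -> continuous g ->
  I (fun x => f x + g x) = I f + I g.
Proof. by move=> cf cg; apply: RintegralD => //; exact: continuous_integrable. Qed.

Lemma integral_TZ (l : R) (f : R -> R) : continuous f ->
  I (fun x => l * f x) = l * I f.
Proof. by move=> cf; apply: RintegralZl => //; exact: continuous_integrable. Qed.

Lemma integral_TN (f : R -> R) : continuous f -> I (fun x => - f x) = - I f.
Proof.
move=> cf; rewrite -mulN1r -integral_TZ//.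
by congr integral_T; apply/funext => x; rewrite mulN1r.
Qed.

Lemma integral_T0 : I (fun=> 0) = 0.
Proof.
transitivity (I (fun x => 0 * (cst 0 x))).
  by congr integral_T; apply/funext => x; rewrite mul0r.
by rewrite integral_TZ ?mul0r//; exact: cst_continuous.
Qed.

Lemma continuous_fun_sum (J : Type) (r : seq J) (f : J -> R -> R) :
  (forall j, continuous (f j)) -> continuous (fun x => \sum_(j <- r) f j x).
Proof.
move=> cf; elim: r => [|j r IH].
  by under eq_fun do rewrite big_nil; exact: cst_continuous.
by under eq_fun do rewrite big_cons; exact: continuous_fun_add.
Qed.

Lemma integral_T_sum (J : Type) (r : seq J) (f : J -> R -> R) :
  (forall j, continuous (f j)) ->
  I (fun x => \sum_(j <- r) f j x) = \sum_(j <- r) I (f j).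
Proof.
move=> cf; elim: r => [|j r IH].
  rewrite big_nil -[RHS]integral_T0.
  by congr integral_T; apply/funext => x; rewrite big_nil.
rewrite big_cons -IH -integral_TD//; last exact: continuous_fun_sum.
by congr integral_T; apply/funext => x; rewrite big_cons.
Qed.

Lemma integral_T_derive (F f : R -> R) : a < b ->
  (forall x : R, is_derive x 1 F (f x)) -> continuous f -> I f = F b - F a.
Proof.
move=> ab dF cf; rewrite /integral_T /Rintegral.
have cF : continuous F.
  by move=> x; apply/differentiable_continuous/derivable1_diffP; case: (dF x).
rewrite (@continuous_FTC2 _ f F a b ab)//.
- exact: continuous_subspaceT.
- split => //.
  + apply: cvg_at_right_filter; exact: cF.
  + apply: cvg_at_left_filter; exact: cF.
- by move=> y _; rewrite derive1E; case: (dF y).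
Qed.

End PeriodIntegral.

(** * The trigonometric basis *)

Section TrigBasis.
Context {R : realType} (a b : R) (N : nat).
Local Notation I := (integral_T a b).
Local Notation L := (period a b).
Local Notation mu := (freq a b).
Local Notation SNf := (@SN_fun R a b N).
Local Notation SNc := (SN_coord a b N).

(** Coordinates are numbered from 0, so coordinate [k] carries the Fourier index [k + 1]; the
    constant mode is absent. *)
Definition omega (k : nat) : R := k.+1%:R * mu.

(* Re (z e_k + conj z e_{-k}) = 2 Re z cos - 2 Im z sin, whence the 2 and the sign. *)
Definition trig_basis (j : 'I_(N + N)) (x : R) : R :=
  match fintype.split j with
  | inl k => 2 * cos (omega k * (x - a))
  | inr k => - (2 * sin (omega k * (x - a)))
  end.

Lemma trig_basis_l k x : trig_basis (lshift N k) x = 2 * cos (omega k * (x - a)).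
Proof. by rewrite /trig_basis (unsplitK (inl k)). Qed.

Lemma trig_basis_r k x : trig_basis (rshift N k) x = - (2 * sin (omega k * (x - a))).
Proof. by rewrite /trig_basis (unsplitK (inr k)). Qed.

Lemma expk_pos (k : nat) x :
  expk a b k.+1%:Z x =
  (cos (omega k * (x - a)) +i* sin (omega k * (x - a)))%C.
Proof. by []. Qed.

Lemma expk_neg (k : nat) x :
  expk a b (- k.+1%:Z) x =
  (cos (omega k * (x - a)) +i* - sin (omega k * (x - a)))%C.
Proof. by rewrite /expk /cis mulrNz !mulNr cosN sinN. Qed.

Lemma SN_funE (q : 'rV[R]_(N + N)) x :
  SNf q x = \sum_j q 0 j * trig_basis j x.
Proof.
rewrite /SN_fun raddf_sum big_split_ord/= -big_split/=.
apply: eq_bigr => k _; rewrite trig_basis_l trig_basis_r.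
by rewrite mulrNz !mulNr cosN sinN/=; rewrite /omega (_ : ord0 = 0)//; ring.
Qed.

Lemma in_SN_SN_fun (f : R -> R) : in_SN a b N f ->
  exists q : 'rV[R]_(N + N), f = SNf q.
Proof.
case=> c fc.
(* The family [c] need not be conjugate symmetric. The witness replaces [c k] by the mean of [c k]
   and the conjugate of [c (- k)], which leaves the real part of the sum unchanged. *)
exists (row_mx
  (\row_(k < N) (2^-1 * (complex.Re (c k.+1%:Z) + complex.Re (c (- k.+1%:Z)))))
  (\row_(k < N) (2^-1 * (complex.Im (c k.+1%:Z) - complex.Im (c (- k.+1%:Z)))))).
apply/funext => x; have /(congr1 (@complex.Re R)) := fc x.
rewrite SN_funE big_split_ord/= -big_split/= => ->.
rewrite /trig_sum big_add1 big_mkord raddf_sum.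
apply: eq_bigr => k _.
rewrite trig_basis_l trig_basis_r expk_pos expk_neg row_mxEl row_mxEr !mxE.
case: (c k.+1%:Z) (c (- k.+1%:Z)) => [c1 c2] [c3 c4].
by simpc => /=; field.
Qed.

Lemma is_derive_phase (k : nat) (x : R) :
  is_derive x 1 (fun x => omega k * (x - a)) (omega k).
Proof.
by apply: is_derive_eq; rewrite subr0 /GRing.scale/= mulr1.
Qed.

Lemma is_derive_trig_l (k : 'I_N) (x : R) :
  is_derive x 1 (trig_basis (lshift N k)) (omega k * trig_basis (rshift N k) x).
Proof.
rewrite (_ : trig_basis _ = fun x => 2 * cos (omega k * (x - a))); last first.
  by apply/funext => y; rewrite trig_basis_l.
rewrite trig_basis_r.
have h := @is_derive1_comp R (@cos R) (fun x => omega k * (x - a)) x _ _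
  (is_derive_cos _) (is_derive_phase k x).
have -> : (fun x => 2 * cos (omega k * (x - a))) =
  2 *: (cos \o (fun x => omega k * (x - a))) by [].
by apply: is_derive_eq; rewrite /GRing.scale/=; ring.
Qed.

Lemma is_derive_trig_r (k : 'I_N) (x : R) :
  is_derive x 1 (trig_basis (rshift N k)) (- omega k * trig_basis (lshift N k) x).
Proof.
rewrite (_ : trig_basis _ = fun x => - (2 * sin (omega k * (x - a)))); last first.
  by apply/funext => y; rewrite trig_basis_r.
rewrite trig_basis_l.
have h := @is_derive1_comp R (@sin R) (fun x => omega k * (x - a)) x _ _
  (is_derive_sin _) (is_derive_phase k x).
have -> : (fun x => - (2 * sin (omega k * (x - a)))) =
  - 2 *: (sin \o (fun x => omega k * (x - a))).
  by apply/funext => y; rewrite -mulNr.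
by apply: is_derive_eq; rewrite /GRing.scale/=; ring.
Qed.

Lemma derivable_trig_basis j x : derivable (trig_basis j) x 1.
Proof.
by case: (split_ordP j) => k ->;
  [case: (is_derive_trig_l k x)|case: (is_derive_trig_r k x)].
Qed.

Lemma continuous_trig_basis j : continuous (trig_basis j).
Proof.
by move=> x; apply/differentiable_continuous/derivable1_diffP/derivable_trig_basis.
Qed.

(** Each coordinate is an inner product with the matching basis function, so [SN_coord] is the
    adjoint of [SN_fun] divided by [2 * L], the squared norm of every basis function when [a < b].
    The symmetry of [PN] rests on this. *)
Lemma SN_coordE (f : R -> R) j : continuous f ->
  SNc f 0 j = (2 * L)^-1 * I (fun x => f x * trig_basis j x).
Proof.
move=> cf; rewrite invfM -mulrA [RHS]mulrCA -integral_TZ; last first.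
  by move=> x; apply: continuousM; [exact: cf|exact: continuous_trig_basis].
have [k ->|k ->] := split_ordP j.
  rewrite row_mxEl mxE /fourier /cintegral_T/=.
  rewrite mul0r subr0; congr (_ * integral_T _ _ _).
  apply/funext => x; rewrite trig_basis_l mulrNz !mulNr cosN sinN /omega/=.
  by field.
rewrite row_mxEr mxE /fourier /cintegral_T/=.
rewrite mul0r addr0; congr (_ * integral_T _ _ _).
apply/funext => x; rewrite trig_basis_r mulrNz !mulNr cosN sinN /omega/=.
by field.
Qed.

(** For real [f] the Fourier coefficient at [- k] is the conjugate of the one at [k], which is the
    symmetry built into [SN_fun]. *)
Lemma PN_SN_fun (f : R -> R) : continuous f -> PN a b N f = SNf (SNc f).
Proof.
move=> cf; apply/funext => x; rewrite /PN /trig_sum /SN_fun big_add1 big_mkord.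
congr (complex.Re _); apply: eq_bigr => k _.
rewrite row_mxEl row_mxEr !mxE; congr (_ * _ + _ * _).
rewrite /fourier/= /cintegral_T; simpc; congr (_ +i* _)%C.
  congr (_ * integral_T _ _ _); apply/funext => y.
  by rewrite expk_pos !mulNr cosN/= /omega; ring.
rewrite -[RHS]mulrN -integral_TN.
  congr (_ * integral_T _ _ _); apply/funext => y.
  by rewrite expk_pos !mulNr sinN/= /omega; ring.
under eq_fun => y.
  rewrite (_ : _ + _ = 2^-1 * (f y * trig_basis (rshift N k) y)); last first.
    by rewrite trig_basis_r /omega !mulNr sinN; field.
  over.
apply: continuous_fun_scale => y.
by apply: continuousM; [exact: cf|exact: continuous_trig_basis].
Qed.

Context (ab : a < b).

Lemma period_gt0 : 0 < L.
Proof. by rewrite subr_gt0. Qed.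

Lemma freq_gt0 : 0 < mu.
Proof. by rewrite divr_gt0 ?period_gt0// mulr_gt0// pi_gt0. Qed.

Lemma omega_gt0 k : 0 < omega k.
Proof. by rewrite mulr_gt0// freq_gt0. Qed.

Lemma omega_neq0 k : omega k != 0.
Proof. by rewrite gt_eqF ?omega_gt0. Qed.

Lemma trig_basis_periodic j : trig_basis j b = trig_basis j a.
Proof.
have e k : omega k * (b - a) = 0 + pi *+ 2 *+ k.+1.
  rewrite add0r /omega /freq -/(period a b) -mulrA divfK ?gt_eqF ?period_gt0//.
  by rewrite -[RHS]mulr_natl -[pi *+ 2]mulr_natl.
have [k ->|k ->] := split_ordP j.
  rewrite !trig_basis_l e (periodicn (@cosD2pi R)) subrr mulr0 //.
by rewrite !trig_basis_r e (periodicn (@sinD2pi R)) subrr mulr0.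
Qed.

Lemma integral_trig_derivM (i j : 'I_(N + N)) (f : R -> R) :
  (forall x : R, is_derive x 1 (fun x => trig_basis i x * trig_basis j x) (f x)) ->
  continuous f -> I f = 0.
Proof.
by move=> df cf; rewrite (integral_T_derive ab df cf) !trig_basis_periodic subrr.
Qed.

Local Notation J i j := (I (fun x => trig_basis i x * trig_basis j x)).
Local Notation tl k := (lshift N k).
Local Notation tr k := (rshift N k).

Lemma continuous_trigM i j :
  continuous (fun x => trig_basis i x * trig_basis j x).
Proof. by move=> x; apply: continuousM; exact: continuous_trig_basis. Qed.

Lemma integral_trig_comb (i j i1 j1 i2 j2 : 'I_(N + N)) (l1 l2 : R) :
  (forall x : R, is_derive x 1 (fun x => trig_basis i x * trig_basis j x)
     (l1 * (trig_basis i1 x * trig_basis j1 x)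
      + l2 * (trig_basis i2 x * trig_basis j2 x))) ->
  l1 * J i1 j1 + l2 * J i2 j2 = 0.
Proof.
move=> df; have c l i' j' : continuous (fun x => l * (trig_basis i' x * trig_basis j' x)).
  by apply: continuous_fun_scale; exact: continuous_trigM.
rewrite -!integral_TZ -?integral_TD; [|exact: c|exact: c|exact: continuous_trigM..].
by apply: integral_trig_derivM df _; apply: continuous_fun_add; exact: c.
Qed.

(* Integrating the derivatives of the four products cos cos, sin sin, cos sin and
   sin cos over the period gives linear relations that force orthogonality. *)
Lemma integral_trig_orth i j : J i j = if i == j then 2 * L else 0.
Proof.
have D1 (k m : 'I_N) : omega k * J (tr k) (tl m) + omega m * J (tl k) (tr m) = 0.
  apply: (@integral_trig_comb (tl k) (tl m)) => x.
  have := is_deriveM (is_derive_trig_l k x) (is_derive_trig_l m x).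
  by move/is_derive_eq; apply; rewrite /GRing.scale/=; ring.
have D2 (k m : 'I_N) : - omega k * J (tl k) (tr m) + - omega m * J (tr k) (tl m) = 0.
  apply: (@integral_trig_comb (tr k) (tr m)) => x.
  have := is_deriveM (is_derive_trig_r k x) (is_derive_trig_r m x).
  by move/is_derive_eq; apply; rewrite /GRing.scale/=; ring.
have D3 (k m : 'I_N) : omega k * J (tr k) (tr m) + - omega m * J (tl k) (tl m) = 0.
  apply: (@integral_trig_comb (tl k) (tr m)) => x.
  have := is_deriveM (is_derive_trig_l k x) (is_derive_trig_r m x).
  by move/is_derive_eq; apply; rewrite /GRing.scale/=; ring.
have D4 (k m : 'I_N) : - omega k * J (tl k) (tl m) + omega m * J (tr k) (tr m) = 0.
  apply: (@integral_trig_comb (tr k) (tl m)) => x.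
  have := is_deriveM (is_derive_trig_r k x) (is_derive_trig_l m x).
  by move/is_derive_eq; apply; rewrite /GRing.scale/=; ring.
have Jsym i' j' : J i' j' = J j' i'.
  by congr integral_T; apply/funext => x; rewrite mulrC.
(* A homogeneous 2 by 2 system whose determinant is, up to sign, the difference of the squares of
   two distinct positive frequencies. *)
have elim (k m : 'I_N) (P Q : R) : k != m ->
    omega k * Q = omega m * P -> omega m * Q = omega k * P -> P = 0 /\ Q = 0.
  move=> km e1 e2.
  have h : (omega k - omega m) * (omega k + omega m) != 0.
    apply: mulf_neq0; last by rewrite gt_eqF// addr_gt0 ?omega_gt0.
    rewrite -mulrBl; apply: mulf_neq0; last by rewrite gt_eqF ?freq_gt0.
    by rewrite subr_eq0 eqr_nat eqSS.
  split; apply: (mulfI h); rewrite mulr0.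
    have : omega k * (omega m * Q) = omega m * (omega k * Q) by ring.
    by rewrite e1 e2 => /eqP; rewrite -subr_eq0 => /eqP <-; ring.
  have : omega k * (omega m * P) = omega m * (omega k * P) by ring.
  by rewrite -e1 -e2 => /eqP; rewrite -subr_eq0 => /eqP <-; ring.
have E1 (k m : 'I_N) : omega k * J (tr k) (tr m) = omega m * J (tl k) (tl m).
  by apply/eqP; rewrite -subr_eq0 -(D3 k m) mulNr.
have E2 (k m : 'I_N) : omega m * J (tr k) (tr m) = omega k * J (tl k) (tl m).
  by apply/eqP; rewrite -subr_eq0 -(D4 k m) mulNr addrC.
have E3 (k m : 'I_N) : omega k * J (tr k) (tl m) = omega m * - J (tl k) (tr m).
  by apply/eqP; rewrite -subr_eq0 -(D1 k m) mulrN opprK.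
have E4 (k m : 'I_N) : omega m * J (tr k) (tl m) = omega k * - J (tl k) (tr m).
  by apply/eqP; rewrite -subr_eq0 -oppr_eq0 opprB; apply/eqP; rewrite -(D2 k m); ring.
have lr0 (k m : 'I_N) : J (tl k) (tr m) = 0.
  have [->|km] := eqVneq k m.
    have := mulfI (omega_neq0 m) (E3 m m); rewrite (Jsym (tr m)).
    by move=> h; lra.
  by have [/eqP] := elim _ _ _ _ km (E3 k m) (E4 k m); rewrite oppr_eq0 => /eqP.
have same (k : 'I_N) : J (tl k) (tl k) = 2 * L /\ J (tr k) (tr k) = 2 * L.
  have e : J (tl k) (tl k) = J (tr k) (tr k).
    by apply: (mulfI (omega_neq0 k)); rewrite E1.
  (* The linear relations only give equality of the two norms; their common value comes from the
     Pythagorean identity. *)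
  suff : J (tl k) (tl k) + J (tr k) (tr k) = 4 * L by rewrite -e => h; split; lra.
  rewrite -integral_TD; [|exact: continuous_trigM|exact: continuous_trigM].
  transitivity (I (fun x => 4 * cst 1 x)).
    congr integral_T; apply/funext => x; rewrite trig_basis_l trig_basis_r.
    transitivity (4 * (cos (omega k * (x - a)) ^+ 2 + sin (omega k * (x - a)) ^+ 2)).
      by ring.
    by rewrite cos2Dsin2.
  rewrite integral_TZ; last exact: cst_continuous.
  rewrite (@integral_T_derive _ _ _ id)//; last exact: cst_continuous.
have [k ->|k ->] := split_ordP i; have [m ->|m ->] := split_ordP j.
- rewrite eq_lshift; have [->|km] := eqVneq; first by case: (same m).
  by case: (elim _ _ _ _ km (E1 k m) (E2 k m)).
- by rewrite eq_lrshift lr0.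
- by rewrite eq_rlshift Jsym lr0.
- rewrite eq_rshift; have [->|km] := eqVneq; first by case: (same m).
  by case: (elim _ _ _ _ km (E1 k m) (E2 k m)).
Qed.

End TrigBasis.

(** * Differentiable families of trigonometric polynomials *)

Lemma near_differentiable (K : numFieldType) (V W : normedModType K)
    (f g : V -> W) (x : V) :
  {near x, f =1 g} -> differentiable f x -> differentiable g x.
Proof.
move=> fg df; have [dfc /eqaddoP fo] := (diff_locallyP _ _).1 df.
have h : g \o shift x = cst (g x) + 'd f x +o_ 0 id.
  apply/eqaddoP => eps eps0; have := fo _ eps0.
  rewrite -(nbhs_singleton fg); apply: filter_app.
  have : \forall y \near (0 : V), f (y + x) = g (y + x).
    by move: fg; rewrite (near_shift 0) subr0.
  by apply: filterS => y fgy; rewrite !fctE /= fgy.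
by apply/diff_locallyP; rewrite (diff_unique dfc h).
Qed.

(** * The space [S_N] in coordinates: projection, derivative and antiderivative *)

Section SNSpace.
Context {R : realType} (a b : R) (N : nat).
Context (ab : a < b).
Local Notation I := (integral_T a b).
Local Notation L := (period a b).
Local Notation SNf := (@SN_fun R a b N).
Local Notation SNc := (SN_coord a b N).
Local Notation V := 'rV[R]_(N + N).
Local Notation e := (@trig_basis R a b N).

Lemma SN_fun_lin (l : R) (c d : V) x : SNf (l *: c + d) x = l * SNf c x + SNf d x.
Proof.
rewrite !SN_funE mulr_sumr -big_split; apply: eq_bigr => j _ /=.
by rewrite !mxE mulrDl mulrA.
Qed.

Lemma SN_funD (c d : V) x : SNf (c + d) x = SNf c x + SNf d x.
Proof. by rewrite -[c]scale1r SN_fun_lin mul1r scale1r. Qed.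

Lemma SN_fun0 : SNf 0 = fun=> 0.
Proof.
by apply/funext => x; rewrite SN_funE big1// => j _; rewrite mxE mul0r.
Qed.

Lemma SN_funZ l (c : V) x : SNf (l *: c) x = l * SNf c x.
Proof. by rewrite -[l *: c]addr0 SN_fun_lin SN_fun0 addr0. Qed.

Lemma SN_fun_sum (J : Type) (r : seq J) (c : J -> V) x :
  SNf (\sum_(j <- r) c j) x = \sum_(j <- r) SNf (c j) x.
Proof.
by elim: r => [|j r IH]; rewrite ?big_nil ?SN_fun0// !big_cons SN_funD IH.
Qed.

Lemma continuous_SN_fun c : continuous (SNf c).
Proof.
have -> : SNf c = fun x => \sum_j c 0 j * e j x.
  by apply/funext => x; rewrite SN_funE.
apply: continuous_fun_sum => j; apply: continuous_fun_scale.
exact: continuous_trig_basis.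
Qed.

Lemma integral_SN_funM c (f : R -> R) : continuous f ->
  I (fun x => SNf c x * f x) = \sum_j c 0 j * I (fun x => f x * e j x).
Proof.
move=> cf.
transitivity (I (fun x => \sum_j c 0 j * (f x * e j x))).
  congr integral_T; apply/funext => x; rewrite SN_funE mulr_suml.
  by apply: eq_bigr => j _; ring.
have h j : continuous (fun x => f x * e j x).
  by apply: continuous_fun_mul => //; exact: continuous_trig_basis.
rewrite integral_T_sum; last by move=> j; apply: continuous_fun_scale.
by apply: eq_bigr => j _; rewrite integral_TZ.
Qed.

Lemma SN_funK c : SNc (SNf c) = c.
Proof.
apply/rowP => j; rewrite SN_coordE; last exact: continuous_SN_fun.
rewrite integral_SN_funM; last exact: continuous_trig_basis.
rewrite (bigD1 j)//= integral_trig_orth// eqxx big1 ?addr0 => [|i ij].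
  by rewrite mulrCA mulVf ?mulr1// mulf_neq0// gt_eqF// period_gt0.
by rewrite integral_trig_orth// eq_sym (negbTE ij) mulr0.
Qed.

Lemma SN_fun_inj : injective SNf.
Proof. exact: can_inj SN_funK. Qed.

Lemma PN_SN c : PN a b N (SNf c) = SNf c.
Proof. by rewrite PN_SN_fun ?SN_funK//; exact: continuous_SN_fun. Qed.

Lemma PN_lin l (f g : R -> R) x : continuous f -> continuous g ->
  PN a b N (fun y => l * f y + g y) x = l * PN a b N f x + PN a b N g x.
Proof.
move=> cf cg; have clf := continuous_fun_scale (l := l) cf.
have cb := @continuous_trig_basis R a b N.
rewrite !PN_SN_fun//; last exact: continuous_fun_add.
rewrite -SN_fun_lin; congr (SNf _ x); apply/rowP => j.
rewrite SN_coordE; last exact: continuous_fun_add.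
rewrite [RHS]mxE [X in X + _]mxE !SN_coordE// mulrCA -mulrDr; congr (_ * _).
have cfe : continuous (fun y => f y * e j y) by exact: continuous_fun_mul.
rewrite -integral_TZ// -integral_TD; [|exact: continuous_fun_scale|exact: continuous_fun_mul].
by congr integral_T; apply/funext => y; rewrite mulrDl mulrA.
Qed.

(** An element of [S_N] sees [f] only through the coordinates of [f], and [PN] keeps exactly
    these. *)
Lemma integral_PN c (f : R -> R) : continuous f ->
  I (fun x => SNf c x * PN a b N f x) = I (fun x => SNf c x * f x).
Proof.
move=> cf; rewrite PN_SN_fun// !integral_SN_funM//; last exact: continuous_SN_fun.
have L0 : (2 * L)^-1 != 0 by rewrite invr_neq0// mulf_neq0// gt_eqF// period_gt0.
apply: eq_bigr => j _; congr (_ * _); apply: (mulfI L0).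
by rewrite -!SN_coordE ?SN_funK//; exact: continuous_SN_fun.
Qed.

(** Multiplication of the Fourier coefficients by i times the frequency, written on real and
    imaginary parts and acting on row vectors from the right. [antideriv_mx] is the corresponding
    division, possible because the constant mode is absent. *)
Definition deriv_mx : 'M[R]_(N + N) :=
  let d := diag_mx (\row_(k < N) omega a b k) in block_mx 0 d (- d) 0.

Definition antideriv_mx : 'M[R]_(N + N) :=
  let d := diag_mx (\row_(k < N) (omega a b k)^-1) in block_mx 0 (- d) d 0.

Lemma deriv_mxK : deriv_mx *m antideriv_mx = 1%:M.
Proof.
rewrite mulmx_block !mul0mx !mulmx0 !add0r !addr0 mulNmx mulmxN opprK mulmx_diag.
rewrite (_ : \row_j _ = const_mx 1) ?diag_const_mx -?scalar_mx_block//.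
by apply/rowP => k; rewrite !mxE mulfV ?omega_neq0.
Qed.

Lemma antideriv_mxK : antideriv_mx *m deriv_mx = 1%:M.
Proof. exact: mulmx1C deriv_mxK. Qed.

Lemma is_derive_SN_fun c (x : R) : is_derive x 1 (SNf c) (SNf (c *m deriv_mx) x).
Proof.
have -> : SNf c = \sum_j c 0 j *: e j.
  apply/funext => y; rewrite SN_funE fct_sumE; apply: eq_bigr => j _.
  by [].
pose de j : R := match fintype.split j with
  | inl k => omega a b k * e (rshift N k) x
  | inr k => - omega a b k * e (lshift N k) x end.
have h j : is_derive x 1 (e j) (de j).
  rewrite /de; case: split_ordP => k ->; first exact: is_derive_trig_l.
  exact: is_derive_trig_r.
apply: (is_derive_eq (is_derive_sum (fun j => is_deriveZ (c 0 j) (h j)))).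
rewrite SN_funE !big_split_ord/= addrC /de.
rewrite -{3 4}[c]hsubmxK mul_row_block !mulmx0 add0r addr0 mulmxN.
congr (_ + _); apply: eq_bigr => k _.
  rewrite (unsplitK (inr k)) row_mxEl mul_mx_diag !mxE /GRing.scale/=; ring.
rewrite (unsplitK (inl k)) row_mxEr mul_mx_diag !mxE /GRing.scale/=; ring.
Qed.

Lemma derive1_SN_fun c : derive1 (SNf c) = SNf (c *m deriv_mx).
Proof. by apply/funext => x; rewrite derive1E; case: (is_derive_SN_fun c x). Qed.

(** [S_N] contains no nonzero constant, so an antiderivative is unique there. This is how the
    components phi and w, known only through their derivatives, are pinned down. *)
Lemma SN_fun_antideriv c d : derive1 (SNf c) = SNf d -> c = d *m antideriv_mx.
Proof.
by rewrite derive1_SN_fun => /SN_fun_inj <-; rewrite -mulmxA deriv_mxK mulmx1.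
Qed.

Lemma integral_SN_fun c : I (SNf c) = 0.
Proof.
have dF (x : R) : is_derive x 1 (SNf (c *m antideriv_mx)) (SNf c x).
  have := is_derive_SN_fun (c *m antideriv_mx) x.
  by rewrite -mulmxA antideriv_mxK mulmx1.
rewrite (integral_T_derive ab dF (@continuous_SN_fun c)) !SN_funE -sumrB.
by rewrite big1// => j _; rewrite trig_basis_periodic// subrr.
Qed.

Lemma fourier_SN_fun0 c : fourier a b (SNf c) 0 = 0.
Proof.
have e1 x : expk a b (- 0) x = 1.
  by rewrite /expk /cis oppr0 mulr0z !mul0r cos0 sin0.
rewrite /fourier; under eq_fun do rewrite e1 mulr1.
by rewrite /cintegral_T/= integral_SN_fun integral_T0 mulr0.
Qed.

(** [dx_inv] selects an antiderivative by choice; the explicit one shows that there is something to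
    select. The hypothesis that the selection lies in [S_N] makes it unique; for the initial state
    this membership is supplied by the stages of the first step. *)
Lemma dx_inv_SN_fun c d : dx_inv a b (SNf c) = SNf d ->
  dx_inv a b (SNf c) = SNf (c *m antideriv_mx).
Proof.
move=> dE.
have [|dF _] := @getPex _ [set F : R -> R |
    (forall x : R, is_derive x 1 F (SNf c x)) /\ fourier a b F 0 = 0].
  exists (SNf (c *m antideriv_mx)); split.
    move=> x; have := is_derive_SN_fun (c *m antideriv_mx) x.
    by rewrite -mulmxA antideriv_mxK mulmx1.
  exact: fourier_SN_fun0.
rewrite dE; congr SNf; apply: SN_fun_antideriv; rewrite -dE.
by apply/funext => x; rewrite derive1E; case: (dF x).
Qed.

(** * Families in [S_N] indexed by the phase variable, and their tangents *)

Section Families.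
Context (q0 : V).
Implicit Types (F G : V -> R -> R) (c : V -> V).

Lemma differentiable_rV c :
  (forall j, differentiable (fun q => c q 0 j : R^o) q0) -> differentiable c q0.
Proof.
move=> dc; have -> : c = \sum_j (fun q => c q 0 j *: delta_mx 0 j).
  by apply/funext => q; rewrite fct_sumE {1}[c q]row_sum_delta.
by apply: differentiable_sum => j; exact: differentiableZl.
Qed.

Lemma differentiable_rV_coord c j :
  differentiable c q0 -> differentiable (fun q => c q 0 j : R^o) q0.
Proof.
move=> dc; apply: (differentiable_comp (g := fun M : V => M 0 j : R^o) dc).
exact: differentiable_coord.
Qed.

(** Membership in [S_N] is asked near [q0], differentiability of the coordinates only at [q0]: this
    is stable under every operation of the method and is all that a first derivative at [q0]
    requires. *)
Definition SN_differentiable F :=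
  exists2 c, differentiable c q0 & \forall q \near q0, F q = SNf (c q).

Lemma SN_differentiable_near F G : (\forall q \near q0, F q = G q) ->
  SN_differentiable F -> SN_differentiable G.
Proof.
move=> FG [c dc Fc]; exists c => //.
by near=> q; rewrite -(near FG q)//; near: q.
Unshelve. all: by end_near. Qed.

Lemma SN_differentiable_cst (h : R -> R) (d : V) : h = SNf d ->
  SN_differentiable (fun=> h).
Proof. by move=> hd; exists (cst d) => //; near=> q. Unshelve. all: by end_near. Qed.

Lemma SN_differentiable_lin l F G : SN_differentiable F -> SN_differentiable G ->
  SN_differentiable (fun q x => l * F q x + G q x).
Proof.
move=> [c dc Fc] [d dd Gd]; exists (l \*: c + d).
  by apply: differentiableD => //; exact: differentiableZ.
near=> q; apply/funext => x; rewrite SN_fun_lin.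
by rewrite (near Fc q)// (near Gd q).
Unshelve. all: by end_near. Qed.

Lemma SN_differentiable0 : SN_differentiable (fun _ _ => 0).
Proof. exact: SN_differentiable_cst (esym SN_fun0). Qed.

Lemma SN_differentiableZ l F : SN_differentiable F ->
  SN_differentiable (fun q x => l * F q x).
Proof.
move=> dF; apply: SN_differentiable_near (SN_differentiable_lin l dF SN_differentiable0).
by near=> q; apply/funext => x; rewrite addr0.
Unshelve. all: by end_near. Qed.

Lemma SN_differentiableD F G : SN_differentiable F -> SN_differentiable G ->
  SN_differentiable (fun q x => F q x + G q x).
Proof.
move=> dF dG; apply: SN_differentiable_near (SN_differentiable_lin 1 dF dG).
by near=> q; apply/funext => x; rewrite mul1r.
Unshelve. all: by end_near. Qed.

Lemma SN_differentiable_sum (J : Type) (r : seq J) (l : J -> R) (F : J -> V -> R -> R) :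
  (forall j, SN_differentiable (F j)) ->
  SN_differentiable (fun q x => \sum_(j <- r) l j * F j q x).
Proof.
move=> dF; elim: r => [|j r IH].
  apply: SN_differentiable_near SN_differentiable0.
  by near=> q; apply/funext => x; rewrite big_nil.
apply: SN_differentiable_near (SN_differentiable_lin (l j) (dF j) IH).
by near=> q; apply/funext => x; rewrite big_cons.
Unshelve. all: by end_near. Qed.

Lemma differentiable_mulmxr c (B : 'M[R]_(N + N)) :
  differentiable c q0 -> differentiable (fun q => c q *m B) q0.
Proof.
move=> dc; apply: differentiable_rV => j.
rewrite (_ : (fun q => _) = \sum_i (fun q => c q 0 i) * cst (B i j)); last first.
  by apply/funext => q; rewrite fct_sumE mxE.
apply: differentiable_sum => i; apply: differentiableM => //.
exact: differentiable_rV_coord.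
Qed.

Lemma SN_differentiable_derive1 F : SN_differentiable F ->
  SN_differentiable (fun q => derive1 (F q)).
Proof.
move=> [c dc Fc]; exists (fun q => c q *m deriv_mx).
  exact: differentiable_mulmxr.
by near=> q; rewrite (near Fc q)// derive1_SN_fun.
Unshelve. all: by end_near. Qed.

Lemma SN_differentiable_antideriv F G : SN_differentiable F ->
  (\forall q \near q0, in_SN a b N (G q) /\ derive1 (G q) = F q) ->
  SN_differentiable G.
Proof.
move=> [c dc Fc] GF; exists (fun q => c q *m antideriv_mx).
  exact: differentiable_mulmxr.
near=> q; have [//|/in_SN_SN_fun[d Gd]] := near GF q _.
rewrite (near Fc q)// Gd => h.
by congr SNf; exact: SN_fun_antideriv.
Unshelve. all: by end_near. Qed.

Lemma SN_differentiable_PNM F G : SN_differentiable F -> SN_differentiable G ->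
  SN_differentiable (fun q => PN a b N (fun x => F q x * G q x)).
Proof.
move=> [c dc Fc] [d dd Gd].
exists (fun q => SNc (fun x => SNf (c q) x * SNf (d q) x)); last first.
  near=> q; have -> : F q = SNf (c q) by near: q.
  have -> : G q = SNf (d q) by near: q.
  rewrite PN_SN_fun//.
  by apply: continuous_fun_mul; exact: continuous_SN_fun.
apply: differentiable_rV => j.
(* The coordinates of the projected product are bilinear in [c q] and [d q]; the constants are
   integrals of triple products of basis functions. *)
rewrite (_ : (fun q => _) = (2 * L)^-1 \*: \sum_i (fun q => c q 0 i) *
   \sum_k (fun q => d q 0 k) * cst (I (fun x => e j x * e i x * e k x))); last first.
  apply/funext => q.
  rewrite SN_coordE; last by apply: continuous_fun_mul; exact: continuous_SN_fun.
  congr (_ * _); under eq_fun do rewrite -mulrA.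
  have cb := continuous_trig_basis.
  rewrite integral_SN_funM; last first.
    by apply: continuous_fun_mul => //; exact: continuous_SN_fun.
  rewrite fct_sumE; apply: eq_bigr => i _; congr (_ * _).
  under eq_fun do rewrite -mulrA.
  rewrite integral_SN_funM; last exact: continuous_fun_mul.
  by rewrite fct_sumE; apply: eq_bigr => k _.
apply: differentiableZ; apply: differentiable_sum => i.
apply: differentiableM; first exact: differentiable_rV_coord.
apply: differentiable_sum => k; apply: differentiableM => //.
exact: differentiable_rV_coord.
Unshelve. all: by end_near. Qed.

(** The stage map [g] takes the current velocity, whereas the phase variable is the initial one; [F]
    is the dependence of the former on the latter. *)
Lemma SN_differentiable_row (s : nat) (g : V -> 'M[R]_(s, N + N)) i F :
  SN_differentiable F -> differentiable g (SNc (F q0)) ->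
  SN_differentiable (fun q => SNf (row i (g (SNc (F q))))).
Proof.
move=> [c dc Fc] dg; exists (fun q => row i (g (c q))); last first.
  by near=> q; rewrite (near Fc q)// SN_funK.
have dgc : differentiable (g \o c) q0.
  by apply: differentiable_comp => //; rewrite (nbhs_singleton Fc) SN_funK in dg.
apply: differentiable_rV => j.
rewrite (_ : (fun q => _) = (fun M : 'M[R]_(s, N + N) => M i j : R^o) \o (g \o c)); last first.
  by apply/funext => q; rewrite mxE.
by apply: differentiable_comp => //; exact: differentiable_coord.
Unshelve. all: by end_near. Qed.

(* The value at [xi] of the exterior derivative of [F], as a function of [x]. *)
Definition tangent F (xi : V) (x : R) : R := 'd (fun q => F q x : R^o) q0 xi.

Lemma is_derive_diff (f : V -> R^o) xi :
  differentiable f q0 -> is_derive q0 xi f ('d f q0 xi).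
Proof. by move=> df; apply: DeriveDef; [exact: diff_derivable|exact: deriveE]. Qed.

Lemma is_derive_coord_sum c xi (h : 'I_(N + N) -> R) : differentiable c q0 ->
  is_derive q0 xi (fun q => \sum_j c q 0 j * h j : R^o)
    (\sum_j 'd (fun q => c q 0 j : R^o) q0 xi * h j).
Proof.
move=> dc.
have -> : (fun q => \sum_j c q 0 j * h j : R^o) = \sum_j (h j \*: (fun q => c q 0 j : R^o)).
  apply/funext => q; rewrite fct_sumE; apply: eq_bigr => j _.
  by rewrite mulrC.
have dcj j := is_derive_diff xi (differentiable_rV_coord j dc).
apply: (is_derive_eq (is_derive_sum (fun j => is_deriveZ (h j) (dcj j)))).
by apply: eq_bigr => j _; rewrite mulrC.
Qed.

Lemma SN_differentiable_eval F x : SN_differentiable F ->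
  differentiable (fun q => F q x : R^o) q0.
Proof.
move=> [c dc Fc]; apply: (near_differentiable
  (f := \sum_j (trig_basis a b j x \*: (fun q => c q 0 j : R^o)))).
  near=> q; have -> : F q = SNf (c q) by near: q.
  by rewrite SN_funE fct_sumE; apply: eq_bigr => j _; rewrite mulrC.
apply: differentiable_sum => j; apply: differentiableZ.
exact: differentiable_rV_coord.
Unshelve. all: by end_near. Qed.

Lemma is_derive_tangent F xi x : SN_differentiable F ->
  is_derive q0 xi (fun q => F q x : R^o) (tangent F xi x).
Proof.
by move=> dF; apply: is_derive_diff; exact: SN_differentiable_eval.
Qed.

Lemma is_derive_unique (f : V -> R^o) xi l l' :
  is_derive q0 xi f l -> is_derive q0 xi f l' -> l = l'.
Proof. by move=> [_ <-] [_ <-]. Qed.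

(** At fixed [x] the value is linear in the coordinates, so differentiation in [q] passes to them.
    The tangent thus stays in [S_N] and may itself be differentiated, projected and integrated in
    [x]. *)
Lemma tangentP F : SN_differentiable F -> exists c,
  [/\ differentiable c q0, \forall q \near q0, F q = SNf (c q) &
    forall xi, tangent F xi = SNf (\row_j 'd (fun q => c q 0 j : R^o) q0 xi)].
Proof.
move=> dF; have [c dc Fc] := dF; exists c; split => // xi.
apply/funext => x; apply: (is_derive_unique (is_derive_tangent xi x dF)).
apply: (@near_eq_is_derive _ _ _ (fun q => \sum_j c q 0 j * trig_basis a b j x : R^o)).
  near=> q; have -> : F q = SNf (c q) by near: q.
  by rewrite SN_funE.
rewrite SN_funE; have := is_derive_coord_sum xi (fun j => trig_basis a b j x) dc.
by under [X in _ -> is_derive _ _ _ X]eq_bigr do rewrite mxE.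
Unshelve. all: by end_near. Qed.

Lemma tangent_derive1 F xi : SN_differentiable F ->
  tangent (fun q => derive1 (F q)) xi = derive1 (tangent F xi).
Proof.
move=> dF; have [c [dc Fc tF]] := tangentP dF; rewrite tF derive1_SN_fun.
have dmx (u : V) x : SNf (u *m deriv_mx) x = \sum_j u 0 j * SNf (row j deriv_mx) x.
  rewrite mulmx_sum_row SN_fun_sum.
  by apply: eq_bigr => j _; rewrite SN_funZ.
apply/funext => x.
apply: (is_derive_unique (is_derive_tangent xi x (SN_differentiable_derive1 dF))).
apply: (@near_eq_is_derive _ _ _
  (fun q => \sum_j c q 0 j * SNf (row j deriv_mx) x : R^o)).
  near=> q; have -> : F q = SNf (c q) by near: q.
  by rewrite derive1_SN_fun dmx.
rewrite dmx; have := is_derive_coord_sum xi (fun j => SNf (row j deriv_mx) x) dc.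
by under [X in _ -> is_derive _ _ _ X]eq_bigr do rewrite mxE.
Unshelve. all: by end_near. Qed.

Lemma PN_SN_funM (u : V) (f : R -> R) x : continuous f ->
  PN a b N (fun y => SNf u y * f y) x =
  \sum_j u 0 j * PN a b N (fun y => e j y * f y) x.
Proof.
move=> cf; have cb := @continuous_trig_basis R a b N.
have ce j : continuous (fun y => e j y * f y) by exact: continuous_fun_mul.
have cu : continuous (fun y => SNf u y * f y).
  by apply: continuous_fun_mul => //; exact: continuous_SN_fun.
rewrite PN_SN_fun//.
have -> : SNc (fun y => SNf u y * f y) = \sum_j u 0 j *: SNc (fun y => e j y * f y).
  apply/rowP => k; rewrite summxE SN_coordE//.
  under eq_fun do rewrite -mulrA.
  rewrite integral_SN_funM; last exact: continuous_fun_mul.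
  rewrite mulr_sumr; apply: eq_bigr => j _.
  rewrite mxE SN_coordE// mulrCA; congr (_ * (_ * integral_T _ _ _)).
  by apply/funext => y; ring.
rewrite SN_fun_sum; apply: eq_bigr => j _.
by rewrite SN_funZ PN_SN_fun.
Qed.

(** At fixed [x] the projected product is a bilinear form in the two coordinate vectors, with
    constants [K i k]; this is the product rule for that form. *)
Lemma tangent_PNM F G xi x : SN_differentiable F -> SN_differentiable G ->
  tangent (fun q => PN a b N (fun y => F q y * G q y)) xi x =
  PN a b N (fun y => tangent F xi y * G q0 y) x +
  PN a b N (fun y => F q0 y * tangent G xi y) x.
Proof.
move=> dF dG; have [c [dc Fc tF]] := tangentP dF.
have [d [dd Gd tG]] := tangentP dG.
apply: (is_derive_unique (is_derive_tangent xi x (SN_differentiable_PNM dF dG))).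
have cb := @continuous_trig_basis R a b N.
have cS := continuous_SN_fun.
pose K i k := PN a b N (fun y => e k y * e i y) x.
have KE i (u : V) : PN a b N (fun y => e i y * SNf u y) x = \sum_k u 0 k * K i k.
  by under [X in PN _ _ _ X]eq_fun do rewrite mulrC; rewrite PN_SN_funM.
apply: (@near_eq_is_derive _ _ _
  (\sum_i (fun q => c q 0 i : R^o) * (fun q => \sum_k d q 0 k * K i k : R^o))).
  near=> q; have -> : F q = SNf (c q) by near: q.
  have -> : G q = SNf (d q) by near: q.
  rewrite PN_SN_funM// fct_sumE; apply: eq_bigr => i _.
  by rewrite KE.
rewrite tF tG (nbhs_singleton Fc) (nbhs_singleton Gd) !PN_SN_funM//.
have dcj i := is_derive_diff xi (differentiable_rV_coord i dc).
have := is_derive_sum (fun i => is_deriveM (dcj i) (is_derive_coord_sum xi (K i) dd)).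
move/is_derive_eq; apply; rewrite -big_split/=; apply: eq_bigr => i _.
rewrite mxE [RHS]addrC !KE; congr (_ + _); last exact: mulrC.
by congr (_ * _); apply: eq_bigr => k _; rewrite mxE.
Unshelve. all: by end_near. Qed.

Lemma tangent_near F G xi : (\forall q \near q0, F q = G q) ->
  SN_differentiable F -> tangent G xi = tangent F xi.
Proof.
move=> FG dF; have dG := SN_differentiable_near FG dF; apply/funext => x.
apply: (is_derive_unique (is_derive_tangent xi x dG)).
apply: near_eq_is_derive (is_derive_tangent xi x dF).
by near=> q; rewrite (near FG q).
Unshelve. all: by end_near. Qed.

Lemma tangentZ l F xi x : SN_differentiable F ->
  tangent (fun q y => l * F q y) xi x = l * tangent F xi x.
Proof.
move=> dF; rewrite /tangent.
have := diffZ l (SN_differentiable_eval x dF).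
by move/(congr1 (fun f : V -> R => f xi)).
Qed.

Lemma tangentD F G xi x : SN_differentiable F -> SN_differentiable G ->
  tangent (fun q y => F q y + G q y) xi x = tangent F xi x + tangent G xi x.
Proof.
move=> dF dG; rewrite /tangent.
have := diffD (SN_differentiable_eval x dF) (SN_differentiable_eval x dG).
by move/(congr1 (fun f : V -> R => f xi)).
Qed.

Lemma tangent0 xi x : tangent (fun _ _ => 0) xi x = 0.
Proof.
rewrite /tangent; have := @diff_cst R V R^o 0 q0.
by move/(congr1 (fun f : V -> R => f xi)).
Qed.

Lemma tangent_sum (J : Type) (r : seq J) (l : J -> R) (F : J -> V -> R -> R) xi x :
  (forall j, SN_differentiable (F j)) ->
  tangent (fun q y => \sum_(j <- r) l j * F j q y) xi x =
  \sum_(j <- r) l j * tangent (F j) xi x.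
Proof.
move=> dF; elim: r => [|j r IH].
  by rewrite big_nil -[RHS](tangent0 xi x); congr tangent;
     apply/funext => q; apply/funext => y; rewrite big_nil.
have dZ := SN_differentiableZ (l j) (dF j).
rewrite big_cons -IH -(tangentZ _ _ _ (dF j)).
rewrite -(tangentD _ _ dZ (SN_differentiable_sum r l dF)).
by congr tangent; apply/funext => q; apply/funext => y; rewrite big_cons.
Qed.

(** [h] is any function of [x], not assumed to lie in [S_N] or even to be continuous: at fixed [x]
    it is a constant in [q]. *)
Lemma tangent_add_cst F G (h : R -> R) xi :
  (\forall q \near q0, forall x, G q x = F q x + h x) ->
  SN_differentiable F -> tangent G xi = tangent F xi.
Proof.
move=> GF dF; apply/funext => x.
have near : {near q0, (fun q => F q x : R^o) + cst (h x) =1 (fun q => G q x : R^o)}.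
  by near=> q; rewrite (near GF q).
have dG : differentiable (fun q => G q x : R^o) q0.
  apply: near_differentiable near _; apply: differentiableD => //.
  exact: SN_differentiable_eval.
apply: (is_derive_unique (is_derive_diff xi dG)).
apply: near_eq_is_derive near _.
by apply: is_derive_eq (is_deriveD (is_derive_tangent xi x dF) _) (addr0 _).
Unshelve. all: by end_near. Qed.

End Families.
End SNSpace.

(** * The variational stage equations *)

Section Gradient.
Context {R : realType}.

Lemma is_derive_entry (z h : 'cV[R]_5) i :
  is_derive z h (fun y : 'cV[R]_5 => y i 0 : R^o) (h i 0).
Proof.
apply: DeriveDef; first exact/diff_derivable/differentiable_coord.
have := derive_mx (@derivable_id R 'cV[R]_5 z h).
by rewrite derive_id => /matrixP/(_ i 0); rewrite mxE.
Qed.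

(** [S1] is cubic, so its gradient contains at most products of two components. Squares are written
    as products to match [tangent_PNM]. *)
Lemma grad_S1 (z : 'cV[R]_5) : grad (@S1 R) z =
  vec5 (- z iw 0 - 3 / 2 * (z iU 0 * z iU 0) - 2^-1 * (z ip 0 * z ip 0)) 0
       (- z iU 0) (z ip 0) (- (z iU 0 * z ip 0) + z iv 0).
Proof.
have d h : 'D_h (@S1 R) z =
    - (h iw 0 * z iU 0 + z iw 0 * h iU 0) - 3 / 2 * (z iU 0 ^+ 2 * h iU 0)
    - 2^-1 * (h iU 0 * z ip 0 ^+ 2 + 2 * (z iU 0 * z ip 0 * h ip 0))
    + (h ip 0 * z iv 0 + z ip 0 * h iv 0).
  have eU := is_derive_entry z h iU; have ew := is_derive_entry z h iw.
  have ev := is_derive_entry z h iv; have ep := is_derive_entry z h ip.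
  set U := (fun y : 'cV[R]_5 => y iU 0 : R^o) in eU.
  set w := (fun y : 'cV[R]_5 => y iw 0 : R^o) in ew.
  set v := (fun y : 'cV[R]_5 => y iv 0 : R^o) in ev.
  set p := (fun y : 'cV[R]_5 => y ip 0 : R^o) in ep.
  have -> : @S1 R = - (w * U) - 2^-1 \*: (U * (U * U)) - 2^-1 \*: (U * (p * p)) + p * v.
    by apply/funext => y; rewrite /S1 exprSr expr2 -mulrA.
  have := is_deriveD (is_deriveB (is_deriveB (is_deriveN (is_deriveM ew eU))
    (is_deriveZ 2^-1 (is_deriveM eU (is_deriveM eU eU))))
    (is_deriveZ 2^-1 (is_deriveM eU (is_deriveM ep ep)))) (is_deriveM ep ev).
  case=> _ ->; rewrite /GRing.scale/= !fctE /U /w /v /p. by field.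
apply/colP => i; rewrite !mxE d !mxE.
case: i => [[|[|[|[|[|//]]]]] ilt]; rewrite /= ?eqxx/=.
all: try by field.
Qed.

Lemma sum5 (F : 'I_5 -> R) : \sum_i F i = F iU + F iphi + F iw + F iv + F ip.
Proof.
rewrite !big_ord_recl big_ord0 addr0 !addrA.
by congr (F _ + F _ + F _ + F _ + F _); apply/val_inj.
Qed.

Lemma Mmx_mulE (z : 'cV[R]_5) : Mmx *m z =
  vec5 (2^-1 * z iphi 0 - 2^-1 * z ip 0) (- (2^-1 * z iU 0)) 0 0 (2^-1 * z iU 0).
Proof.
apply/colP => i; rewrite !mxE sum5 !mxE.
by case: i => [[|[|[|[|[|//]]]]] ilt] /=; ring.
Qed.

Lemma Kmx_mulE (z : 'cV[R]_5) :
  Kmx *m z = vec5 (- z iv 0) (z iw 0) (- z iphi 0) (z iU 0) 0.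
Proof.
apply/colP => i; rewrite !mxE sum5 !mxE.
by case: i => [[|[|[|[|[|//]]]]] ilt] /=; ring.
Qed.

End Gradient.

(** * Cancellation of the projected Hessian terms within one stage *)

Section StageIdentity.
Context {R : realType} (a b : R) (N : nat).
Context (ab : a < b).
Local Notation I := (integral_T a b).
Local Notation SNf := (@SN_fun R a b N).
Local Notation V := 'rV[R]_(N + N).
Local Notation PN := (PN a b N).

(** Continuity is bundled in because additivity of the integral requires integrability. *)
Definition null_integral (f : R -> R) := continuous f /\ I f = 0.

Lemma null_integral_lin l f g : null_integral f -> null_integral g ->
  null_integral (fun x => l * f x + g x).
Proof.
move=> [cf f0] [cg g0]; have cl := continuous_fun_scale (l := l) cf.
by split; [exact: continuous_fun_add|rewrite integral_TD// integral_TZ// f0 g0 mulr0 addr0].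
Qed.

Lemma null_integral0 : null_integral (fun=> 0).
Proof. by split; [exact: cst_continuous|exact: integral_T0]. Qed.

Lemma null_integral_PN c (f : R -> R) : continuous f ->
  null_integral (fun x => SNf c x * (PN f x - f x)).
Proof.
move=> cf; have cP : continuous (PN f).
  by rewrite PN_SN_fun//; exact: continuous_SN_fun.
have cS := @continuous_SN_fun R a b N c.
have e : (fun x => SNf c x * (PN f x - f x)) =
    fun x => SNf c x * PN f x + -1 * (SNf c x * f x).
  by apply/funext => x; ring.
have c1 : continuous (fun x => SNf c x * PN f x) by exact: continuous_fun_mul.
have c2 : continuous (fun x => SNf c x * f x) by exact: continuous_fun_mul.
rewrite e; split.
  by apply: continuous_fun_add => //; exact: continuous_fun_scale.
rewrite integral_TD//; last exact: continuous_fun_scale.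
by rewrite integral_TZ// integral_PN// mulN1r subrr.
Qed.

(* X^T M Y; the components w and v do not enter. *)
Definition mform (XU Xphi Xp YU Yphi Yp : R) : R :=
  2^-1 * (XU * Yphi - XU * Yp - Xphi * YU + Xp * YU).

(* X^T K Y. *)
Definition kform (XU Xphi Xw Xv YU Yphi Yw Yv : R -> R) (x : R) : R :=
  - (XU x * Yv x) + Xphi x * Yw x - Xw x * Yphi x + Xv x * YU x.

(* The stage equations differentiated in the phase variable at a state with
   components U and p, for X = dZ_i and K = dQ_i. *)
Definition linear_stage (U p : R -> R) (XU Xphi Xw Xv Xp KU Kphi Kp : R -> R) :=
  [/\ forall x, derive1 Xw x = 2^-1 * KU x,
      derive1 Xphi = XU,
      derive1 XU = Xp,
      forall x, 2^-1 * KU x =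
        Xv x - (PN (fun y => XU y * p y) x + PN (fun y => U y * Xp y) x)
    & forall x, 2^-1 * Kphi x - 2^-1 * Kp x - derive1 Xv x =
        - Xw x - 3 / 2 * (PN (fun y => XU y * U y) x + PN (fun y => U y * XU y) x)
        - 2^-1 * (PN (fun y => Xp y * p y) x + PN (fun y => p y * Xp y) x)].

Definition in_span (f : R -> R) := exists c : V, f = SNf c.

Lemma in_SN_span f : in_SN a b N f -> in_span f.
Proof. exact: in_SN_SN_fun. Qed.

Lemma in_span_lin l f g : in_span f -> in_span g -> in_span (fun x => l * f x + g x).
Proof.
by move=> [c ->] [d ->]; exists (l *: c + d); apply/funext => x; rewrite SN_fun_lin.
Qed.

Lemma in_span_sum (J : Type) (r : seq J) (l : J -> R) (f : J -> R -> R) :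
  (forall j, in_span (f j)) -> in_span (fun x => \sum_(j <- r) l j * f j x).
Proof.
move=> sf; elim: r => [|j r IH].
  by exists 0; rewrite SN_fun0; apply/funext => x; rewrite big_nil.
have := in_span_lin (l j) (sf j) IH; congr in_span.
by apply/funext => x; rewrite big_cons.
Qed.

Lemma in_span_continuous f : in_span f -> continuous f.
Proof. by move=> [c ->]; exact: continuous_SN_fun. Qed.

Lemma in_span_derivable f x : in_span f -> derivable f x 1.
Proof. by move=> [c ->]; case: (@is_derive_SN_fun R a b N c x). Qed.

Lemma in_span_null f g : in_span f -> continuous g ->
  null_integral (fun x => f x * (PN g x - g x)).
Proof. by move=> [c ->]; exact: null_integral_PN. Qed.

(** After substitution of the stage equations the integrand is exactly a combination of terms
    [f * (PN (g * h) - g * h)] with [f] in [S_N], and each of these has integral zero. *)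
Lemma linear_stage_identity (U p : R -> R)
    (XU Xphi Xw Xv Xp KU Kphi Kp YU Yphi Yw Yv Yp LU Lphi Lp : R -> R) :
  in_span U -> in_span p ->
  in_span XU -> in_span Xphi -> in_span Xw -> in_span Xv -> in_span Xp ->
  in_span YU -> in_span Yphi -> in_span Yw -> in_span Yv -> in_span Yp ->
  linear_stage U p XU Xphi Xw Xv Xp KU Kphi Kp ->
  linear_stage U p YU Yphi Yw Yv Yp LU Lphi Lp ->
  null_integral (fun x =>
    mform (KU x) (Kphi x) (Kp x) (YU x) (Yphi x) (Yp x)
    + mform (XU x) (Xphi x) (Xp x) (LU x) (Lphi x) (Lp x)
    + derive1 (kform XU Xphi Xw Xv YU Yphi Yw Yv) x).
Proof.
move=> sU sp sXU sXphi sXw sXv sXp sYU sYphi sYw sYv sYp.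
move=> [Xw' Xphi' XU' X4 X0] [Yw' Yphi' YU' Y4 Y0].
have dk x : derive1 (kform XU Xphi Xw Xv YU Yphi Yw Yv) x =
    - (XU x * derive1 Yv x + YU x * 0 + Yv x * Xp x)
    + (Xphi x * (2^-1 * LU x) + Yw x * XU x)
    - (Xw x * YU x + Yphi x * (2^-1 * KU x))
    + (Xv x * Yp x + YU x * derive1 Xv x).
  have d f : in_span f -> is_derive x 1 f ('D_1 f x).
    by move=> sf; apply/derivableP/in_span_derivable.
  have := is_deriveD (is_deriveB (is_deriveD (is_deriveN (is_deriveM (d _ sXU) (d _ sYv)))
    (is_deriveM (d _ sXphi) (d _ sYw))) (is_deriveM (d _ sXw) (d _ sYphi)))
    (is_deriveM (d _ sXv) (d _ sYU)).
  move=> h; rewrite derive1E; apply: (etrans (@derive_val _ _ _ _ _ _ _ h)).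
  rewrite -!derive1E Xw' Yw' XU' YU' Xphi' Yphi' /GRing.scale/=; ring.
pose n f g := fun x => f x * (PN g x - g x).
have nn f g h : in_span f -> in_span g -> in_span h ->
    null_integral (n f (fun x => g x * h x)).
  move=> sf sg sh; apply: in_span_null => //.
  by apply: continuous_fun_mul; exact: in_span_continuous.
(* One term for each of the twelve projected products in [X0], [Y0], [X4] and [Y4]. The factors 3/2
   and 1/2 come from the U-row of the gradient of [S1], the factor 1 from its p-row. Both orders of
   a product occur, as the product rule delivers them. The unprojected parts add up to zero: this is
   the symmetry of the Hessian. *)
have := null_integral_lin (- (3 / 2)) (nn XU YU U sXU sYU sU)
  (null_integral_lin (- (3 / 2)) (nn XU U YU sXU sU sYU)
  (null_integral_lin (3 / 2) (nn YU XU U sYU sXU sU)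
  (null_integral_lin (3 / 2) (nn YU U XU sYU sU sXU)
  (null_integral_lin (- 2^-1) (nn XU Yp p sXU sYp sp)
  (null_integral_lin (- 2^-1) (nn XU p Yp sXU sp sYp)
  (null_integral_lin 2^-1 (nn YU Xp p sYU sXp sp)
  (null_integral_lin 2^-1 (nn YU p Xp sYU sp sXp)
  (null_integral_lin (- 1) (nn Xp YU p sXp sYU sp)
  (null_integral_lin (- 1) (nn Xp U Yp sXp sU sYp)
  (null_integral_lin 1 (nn Yp XU p sYp sXU sp)
  (null_integral_lin 1 (nn Yp U Xp sYp sU sXp) null_integral0))))))))))).
rewrite (_ : (fun x => _) = fun x => mform (KU x) (Kphi x) (Kp x) (YU x) (Yphi x) (Yp x)
    + mform (XU x) (Xphi x) (Xp x) (LU x) (Lphi x) (Lp x)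
    + derive1 (kform XU Xphi Xw Xv YU Yphi Yw Yv) x)//.
apply/funext => x; rewrite dk /mform /n.
have double (r t : R) : 2^-1 * r = t -> r = 2 * t by move=> <-; field.
have shift (p1 p2 r t : R) : p1 - p2 - r = t -> r = p1 - p2 - t by move=> <-; ring.
rewrite (double _ _ (X4 x)) (double _ _ (Y4 x)) (shift _ _ _ _ (X0 x)) (shift _ _ _ _ (Y0 x)).
(* Projected products and function values become atoms; a field identity is left. *)
do !match goal with |- context [PN ?f x] => generalize (PN f x) => ? end.
do !match goal with |- context [?f x] => is_var f; generalize (f x) => ? end.
by field.
Qed.

End StageIdentity.

(** * Symplectic Runge-Kutta steps *)

(** In the term of order [tau ^+ 2] the weight [bw i * bw j] of [k i * l j] splits by the symplectic
    condition into two parts. One is absorbed by passing from [y] to [Y i], the other by passing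
    from [x] to [X j]. *)
Lemma symplectic_rk_product (R : comPzRingType) (s : nat) (A : 'M[R]_s)
    (bw : 'I_s -> R) (tau x y : R) (k l X Y : 'I_s -> R) :
  (forall i j, bw i * A i j + bw j * A j i = bw i * bw j) ->
  (forall i, X i = x + tau * \sum_j A i j * k j) ->
  (forall i, Y i = y + tau * \sum_j A i j * l j) ->
  (x + tau * \sum_i bw i * k i) * (y + tau * \sum_i bw i * l i) - x * y =
  tau * \sum_i bw i * (k i * Y i + X i * l i).
Proof.
move=> hs hX hY.
have e1 : \sum_i bw i * (k i * Y i) =
    (\sum_i bw i * k i) * y + tau * \sum_i \sum_j bw i * A i j * (k i * l j).
  rewrite mulr_suml mulr_sumr -big_split; apply: eq_bigr => i _ /=.
  rewrite hY mulrDr mulrDr; congr (_ + _); first by ring.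
  rewrite !mulr_sumr; apply: eq_bigr => j _; ring.
have e2 : \sum_i bw i * (X i * l i) =
    x * (\sum_i bw i * l i) + tau * \sum_i \sum_j bw j * A j i * (k i * l j).
  rewrite [in RHS]exchange_big mulr_sumr mulr_sumr -big_split.
  apply: eq_bigr => i _ /=.
  rewrite hX mulrDl mulrDr; congr (_ + _); first by ring.
  rewrite !(mulr_sumr, mulr_suml); apply: eq_bigr => j _; ring.
have e3 : (\sum_i bw i * k i) * (\sum_i bw i * l i) =
    \sum_i \sum_j bw i * A i j * (k i * l j) + \sum_i \sum_j bw j * A j i * (k i * l j).
  rewrite mulr_suml -big_split; apply: eq_bigr => i _ /=.
  rewrite mulr_sumr -big_split; apply: eq_bigr => j _ /=.
  by rewrite -mulrDl hs; ring.
rewrite [in RHS](eq_bigr _ (fun i _ => mulrDr _ _ _)) big_split/= e1 e2.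
rewrite (_ : (x + _) * _ - _ = tau * (\sum_i bw i * k i * y + x * (\sum_i bw i * l i) +
  tau * ((\sum_i bw i * k i) * (\sum_i bw i * l i)))); last by rewrite -mulr_suml; ring.
by rewrite e3 -mulr_suml; ring.
Qed.

Lemma symplectic_rk_mform (R : realType) (s : nat) (A : 'M[R]_s) (bw : 'I_s -> R)
    (tau xU xphi xp yU yphi yp : R)
    (kU kphi kp lU lphi lp XU Xphi Xp YU Yphi Yp : 'I_s -> R) :
  (forall i j, bw i * A i j + bw j * A j i = bw i * bw j) ->
  (forall i, XU i = xU + tau * \sum_j A i j * kU j) ->
  (forall i, Xphi i = xphi + tau * \sum_j A i j * kphi j) ->
  (forall i, Xp i = xp + tau * \sum_j A i j * kp j) ->
  (forall i, YU i = yU + tau * \sum_j A i j * lU j) ->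
  (forall i, Yphi i = yphi + tau * \sum_j A i j * lphi j) ->
  (forall i, Yp i = yp + tau * \sum_j A i j * lp j) ->
  mform (xU + tau * \sum_i bw i * kU i) (xphi + tau * \sum_i bw i * kphi i)
        (xp + tau * \sum_i bw i * kp i) (yU + tau * \sum_i bw i * lU i)
        (yphi + tau * \sum_i bw i * lphi i) (yp + tau * \sum_i bw i * lp i) =
  mform xU xphi xp yU yphi yp + tau * \sum_i bw i *
    (mform (kU i) (kphi i) (kp i) (YU i) (Yphi i) (Yp i)
     + mform (XU i) (Xphi i) (Xp i) (lU i) (lphi i) (lp i)).
Proof.
move=> symp hXU hXphi hXp hYU hYphi hYp.
have e1 := symplectic_rk_product symp hXU hYphi.
have e2 := symplectic_rk_product symp hXU hYp.
have e3 := symplectic_rk_product symp hXphi hYU.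
have e4 := symplectic_rk_product symp hXp hYU.
have -> : \sum_i bw i * (mform (kU i) (kphi i) (kp i) (YU i) (Yphi i) (Yp i)
     + mform (XU i) (Xphi i) (Xp i) (lU i) (lphi i) (lp i)) =
    2^-1 * (\sum_i bw i * (kU i * Yphi i + XU i * lphi i)
    - \sum_i bw i * (kU i * Yp i + XU i * lp i)
    - \sum_i bw i * (kphi i * YU i + Xphi i * lU i)
    + \sum_i bw i * (kp i * YU i + Xp i * lU i)).
  rewrite -!sumrB -big_split mulr_sumr.
  by apply: eq_bigr => i _ /=; rewrite /mform; ring.
by rewrite mulrCA mulrDr !mulrBr -e1 -e2 -e3 -e4 /mform; ring.
Qed.

(** As [Mmx] is skew-symmetric, the two halves of the wedge agree; the resulting 2 cancels the
    factor in [OmegaN]. The same holds for [Kmx] and [KN]. *)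
Lemma wedge_Mmx (R : realType) (u v : 'cV[R]_5) :
  \sum_i (u i 0 * (Mmx *m v) i 0 - v i 0 * (Mmx *m u) i 0) =
  2 * mform (u iU 0) (u iphi 0) (u ip 0) (v iU 0) (v iphi 0) (v ip 0).
Proof. by rewrite sum5 !Mmx_mulE !mxE/= /mform; field. Qed.

Lemma wedge_Kmx (R : realType) (u v : 'cV[R]_5) :
  \sum_i (u i 0 * (Kmx *m v) i 0 - v i 0 * (Kmx *m u) i 0) =
  2 * (- (u iU 0 * v iv 0) + u iphi 0 * v iw 0 - u iw 0 * v iphi 0 + u iv 0 * v iU 0).
Proof. by rewrite sum5 !Kmx_mulE !mxE/=; ring. Qed.

(** * One step of the method and its derivative in the phase variable *)

Section OneStep.
Context {R : realType} (a b : R) (N : nat).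
Context (ab : a < b).
Local Notation I := (integral_T a b).
Local Notation SNf := (@SN_fun R a b N).
Local Notation SNc := (SN_coord a b N).
Local Notation V := 'rV[R]_(N + N).
Local Notation PN := (PN a b N).
Local Notation SNd q0 := (@SN_differentiable R a b N q0).

Context (s : nat) (A : 'M[R]_s) (bw : 'I_s -> R) (tau : R).
Context (symp : forall i j, bw i * A i j + bw j * A j i = bw i * bw j).
Context (hA : A \in unitmx).
Context (tau0 : tau != 0).

(** Rows phi, w, v, p and U of the stage system, in this order. Stage components lie in [S_N], so
    [PN] disappears from the linear terms and survives only on products. *)
Lemma rk_stage_equations (noise Z Z' : @state R) (Zs Qs : 'I_s -> @state R) i :
  rk_step a b N A bw tau noise Z Zs Qs Z' ->
  let U := component (Zs i) iU in let phi := component (Zs i) iphi in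
  let w := component (Zs i) iw in let v := component (Zs i) iv in
  let p := component (Zs i) ip in
  [/\ forall x, derive1 w x = 2^-1 * component (Qs i) iU x,
      derive1 phi = U, derive1 U = p,
      forall x, v x = 2^-1 * component (Qs i) iU x + PN (fun y => U y * p y) x
    & forall x, 2^-1 * component (Qs i) iphi x - 2^-1 * component (Qs i) ip x
        - derive1 v x = - w x - 3 / 2 * PN (fun y => U y * U y) x
                        - 2^-1 * PN (fun y => p y * p y) x].
Proof.
move=> [inSN _ eqs _ _] U phi w v p.
have [cU eU] := in_SN_SN_fun ((inSN i).1 iU).
have [cw ew] := in_SN_SN_fun ((inSN i).1 iw).
have [cv ev] := in_SN_SN_fun ((inSN i).1 iv).
have [cp ep] := in_SN_SN_fun ((inSN i).1 ip).
have e x := eqs i x.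
have eqr r x := congr1 (fun M : 'cV[R]_5 => M r 0) (e x).
have {}eqr r x : (Mmx *m Qs i x) r 0 + (Kmx *m dx (Zs i) x) r 0 =
    PN (fun y => grad (@S1 R) (Zs i y) r 0) x.
  by have := eqr r x; rewrite !mxE.
have gE r y := congr1 (fun M : 'cV[R]_5 => M r 0) (grad_S1 (Zs i y)).
have cc (c : V) := continuous_SN_fun (a := a) (b := b) (c := c).
have cU' : continuous U by rewrite /U eU.
have cp' : continuous p by rewrite /p ep.
have cv' : continuous v by rewrite /v ev.
have cw' : continuous w by rewrite /w ew.
have E1 x : derive1 w x = 2^-1 * component (Qs i) iU x.
  have := eqr iphi x; under eq_fun do rewrite gE mxE/=.
  rewrite -(SN_fun0 a b N) PN_SN// SN_fun0 Mmx_mulE Kmx_mulE !mxE/=.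
  by move/eqP; rewrite addrC subr_eq0 => /eqP.
have E2 x : derive1 phi x = U x.
  have := eqr iw x; under eq_fun do rewrite gE mxE/=.
  rewrite (_ : (fun y => _) = SNf (-1 *: cU)); last first.
    by apply/funext => y; rewrite SN_funZ -eU mulN1r.
  rewrite PN_SN// SN_funZ -eU Mmx_mulE Kmx_mulE !mxE/= add0r mulN1r.
  exact: oppr_inj.
have E3 x : derive1 U x = p x.
  have := eqr iv x; under eq_fun do rewrite gE mxE/=.
  rewrite (_ : (fun y => _) = SNf cp) -?ep//.
  by rewrite ep PN_SN// -ep Mmx_mulE Kmx_mulE !mxE/= add0r.
have E4 x : v x = 2^-1 * component (Qs i) iU x + PN (fun y => U y * p y) x.
  have := eqr ip x; under eq_fun do rewrite gE mxE/=.
  rewrite (_ : (fun y => _) = fun y => -1 * (U y * p y) + v y); last first.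
    by apply/funext => y; rewrite mulN1r.
  rewrite PN_lin//; last exact: continuous_fun_mul.
  rewrite [in PN v x]/v ev PN_SN// -ev -/v Mmx_mulE Kmx_mulE !mxE/=.
  by rewrite addr0 mulN1r => ->; rewrite addrAC addNr add0r.
split=> // [||x]; [exact/funext|exact/funext|].
have := eqr iU x; under eq_fun do rewrite gE mxE/=.
rewrite (_ : (fun y => _) =
    fun y => - (3 / 2) * (U y * U y) + (- 2^-1 * (p y * p y) + -1 * w y)); last first.
  by apply/funext => y; rewrite /U /p /w /component; ring.
have cUU : continuous (fun y => U y * U y) by exact: continuous_fun_mul.
have cpp : continuous (fun y => p y * p y) by exact: continuous_fun_mul.
have cN : continuous (fun y => -1 * w y) by exact: continuous_fun_scale.
rewrite PN_lin//; last by apply: continuous_fun_add => //; exact: continuous_fun_scale.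
rewrite PN_lin// (_ : (fun y => -1 * w y) = SNf (-1 *: cw)); last first.
  by apply/funext => y; rewrite SN_funZ -ew.
rewrite PN_SN// SN_funZ -ew Mmx_mulE Kmx_mulE !mxE/= => ->.
by rewrite -/w; ring.
Qed.

Lemma rk_stage_derivative (noise Z Z' : @state R) (Zs Qs : 'I_s -> @state R) i r x :
  rk_step a b N A bw tau noise Z Zs Qs Z' ->
  component (Qs i) r x =
  \sum_j (tau^-1 * invmx A i j) * (-1 * component Z r x + component (Zs j) r x).
Proof.
move=> [_ eqs _ _ _].
have e j : -1 * component Z r x + component (Zs j) r x =
    tau * (A *m (\col_l component (Qs l) r x)) j 0.
  rewrite /component eqs !mxE summxE mulN1r addKr; congr (_ * _).
  by apply: eq_bigr => l _; rewrite !mxE.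
under eq_bigr do rewrite e mulrACA mulVf// mul1r.
have := congr1 (fun M : 'cV_s => M i 0) (mulKmx hA (\col_l component (Qs l) r x)).
by rewrite mxE [RHS]mxE => <-.
Qed.

(** The state before a step is a stage value minus a combination of stage derivatives, all of them
    in [S_N]; some stage [i] must exist for this. *)
Lemma rk_step_in_span (noise Z Z' : @state R)
    (Zs Qs : 'I_s -> @state R) (i : 'I_s) r :
  rk_step a b N A bw tau noise Z Zs Qs Z' -> in_span a b N (component Z r).
Proof.
move=> [inSN eqs _ _ _].
have sQ j := in_SN_span ((inSN j).2 r).
have := in_span_lin (- tau) (in_span_sum (index_enum _) (A i) sQ)
  (in_SN_span ((inSN i).1 r)).
congr in_span; apply/funext => x; rewrite {2}/component eqs !mxE summxE.
under [X in _ + tau * X]eq_bigr do rewrite mxE.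
by rewrite /component; ring.
Qed.

(* The limit defining the noise may be a junk value; that it lies in S_N is read off
   the stage system of the following step. *)
Lemma rk_step_noise_in_span (noise Z Z' : @state R)
    (Zs Qs : 'I_s -> @state R) (i : 'I_s) r :
  rk_step a b N A bw tau noise Z Zs Qs Z' -> in_span a b N (component Z' r) ->
  in_span a b N (component noise r).
Proof.
move=> h sZ'; have sZ := rk_step_in_span i r h; have [inSN _ _ _ next] := h.
have sQ j := in_SN_span ((inSN j).2 r).
have := in_span_lin (-1) sZ
  (in_span_lin (- tau) (in_span_sum (index_enum _) bw sQ) sZ').
congr in_span; apply/funext => x; rewrite {3}/component next !mxE summxE.
under [X in _ + tau * X + _]eq_bigr do rewrite mxE.
by rewrite /component; ring.
Qed.

Lemma OmegaN_mform (q0 : V) (Z : V -> @state R) xi eta :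
  let t r := tangent q0 (fun q => component (Z q) r) in
  let f x := mform (t iU xi x) (t iphi xi x) (t ip xi x)
                   (t iU eta x) (t iphi eta x) (t ip eta x) in
  continuous f -> OmegaN a b Z q0 xi eta = I f.
Proof.
move=> t f cf; rewrite /OmegaN.
rewrite (_ : (fun x => _) = fun x => 2 * f x).
  by rewrite integral_TZ// mulrA mulVf// mul1r.
by apply/funext => x; rewrite /wedge_prod /mulform wedge_Mmx !mxE.
Qed.

Lemma KN_kform (q0 : V) (Z : V -> @state R) xi eta :
  let t r := tangent q0 (fun q => component (Z q) r) in
  (fun y => KN Z q0 y xi eta) =
  kform (t iU xi) (t iphi xi) (t iw xi) (t iv xi)
        (t iU eta) (t iphi eta) (t iw eta) (t iv eta).
Proof.
move=> t; apply/funext => x.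
by rewrite /KN /wedge_prod /mulform wedge_Kmx mulrA mulVf// mul1r !mxE.
Qed.

Section Families.
Context (q0 : V) (noise : @state R) (Z Z' : V -> @state R)
  (Zs Qs : V -> 'I_s -> @state R).
Context (g : V -> 'M[R]_(s, N + N)).
Context (step : \forall q \near q0,
  rk_step a b N A bw tau noise (Z q) (Zs q) (Qs q) (Z' q) /\
  forall i, component (Zs q i) iU = SNf (row i (g (SNc (component (Z q) iU))))).
Context (dg : differentiable g (SNc (component (Z q0) iU))).

Local Notation Zc r := (fun q => component (Z q) r).
Local Notation Sc i r := (fun q => component (Zs q i) r).
Local Notation Qc i r := (fun q => component (Qs q i) r).
Local Notation t := (tangent q0).

(* The components w and v of Z are never differentiated, as M annihilates them. *)
Context (dZU : SNd q0 (Zc iU)).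
Context (dZphi : SNd q0 (Zc iphi)).
Context (dZp : SNd q0 (Zc ip)).

Let stepE i := filterS (fun q h => rk_stage_equations i (proj1 h)) step.

Lemma diff_stage_U i : SNd q0 (Sc i iU).
Proof.
apply: SN_differentiable_near (SN_differentiable_row ab i dZU dg).
by near=> q; have [//|_ ->] := near step q _.
Unshelve. all: by end_near. Qed.

Lemma diff_stage_phi i : SNd q0 (Sc i iphi).
Proof.
apply: SN_differentiable_antideriv (diff_stage_U i) _ => //.
near=> q; split; last by have [] := near (stepE i) q _.
by have [//|[inSN _ _ _ _] _] := near step q _; exact: (inSN i).1.
Unshelve. all: by end_near. Qed.

Lemma diff_stage_p i : SNd q0 (Sc i ip).
Proof.
apply: SN_differentiable_near (SN_differentiable_derive1 (diff_stage_U i)).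
by near=> q; have [] := near (stepE i) q _.
Unshelve. all: by end_near. Qed.

Lemma diff_stage_derivative r i :
  SNd q0 (Zc r) -> (forall j, SNd q0 (Sc j r)) -> SNd q0 (Qc i r).
Proof.
move=> dZ dS.
apply: SN_differentiable_near (SN_differentiable_sum _
  (fun j => tau^-1 * invmx A i j) (fun j => SN_differentiable_lin (-1) dZ (dS j))).
near=> q; apply/funext => x; apply/esym.
by have [//|h _] := near step q _; rewrite (rk_stage_derivative i r x h).
Unshelve. all: by end_near. Qed.

Lemma diff_stage_w i : SNd q0 (Sc i iw).
Proof.
apply: SN_differentiable_antideriv
  (SN_differentiableZ 2^-1 (diff_stage_derivative i dZU diff_stage_U)) _ => //.
near=> q; split; last by apply/funext => x; have [] := near (stepE i) q _.
by have [//|[inSN _ _ _ _] _] := near step q _; exact: (inSN i).1.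
Unshelve. all: by end_near. Qed.

Lemma diff_stage_v i : SNd q0 (Sc i iv).
Proof.
apply: SN_differentiable_near (SN_differentiableD
  (SN_differentiableZ 2^-1 (diff_stage_derivative i dZU diff_stage_U))
  (SN_differentiable_PNM (diff_stage_U i) (diff_stage_p i))).
by near=> q; apply/funext => x; have [//|_ _ _ -> _] := near (stepE i) q _.
Unshelve. all: by end_near. Qed.

Lemma in_span_tangent F xi : SNd q0 F -> in_span a b N (t F xi).
Proof. by move=> dF; have [c [_ _ ->]] := tangentP dF; eexists. Qed.

Lemma in_span_at F : SNd q0 F -> in_span a b N (F q0).
Proof. by move=> [c _ Fc]; exists (c q0); exact: nbhs_singleton Fc. Qed.

(** The stage equations hold for all [q] near [q0], hence their two sides have equal tangents. *)
Lemma linear_stage_tangent i xi :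
  linear_stage a b N (component (Zs q0 i) iU) (component (Zs q0 i) ip)
    (t (Sc i iU) xi) (t (Sc i iphi) xi) (t (Sc i iw) xi) (t (Sc i iv) xi)
    (t (Sc i ip) xi) (t (Qc i iU) xi) (t (Qc i iphi) xi) (t (Qc i ip) xi).
Proof.
have dQU := diff_stage_derivative i dZU diff_stage_U.
have dQphi := diff_stage_derivative i dZphi diff_stage_phi.
have dQp := diff_stage_derivative i dZp diff_stage_p.
have dUp := SN_differentiable_PNM (diff_stage_U i) (diff_stage_p i).
have dUU := SN_differentiable_PNM (diff_stage_U i) (diff_stage_U i).
have dpp := SN_differentiable_PNM (diff_stage_p i) (diff_stage_p i).
split.
- move=> x; rewrite -(tangent_derive1 xi (diff_stage_w i)).
  rewrite -(tangentZ _ _ _ dQU) (tangent_near xi _ (SN_differentiableZ 2^-1 dQU))//.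
  by near=> q; apply/funext => y; have [//|-> _ _ _ _] := near (stepE i) q _.
- rewrite -(tangent_derive1 xi (diff_stage_phi i)).
  rewrite (tangent_near xi _ (diff_stage_U i))//.
  by near=> q; have [//|_ -> _ _ _] := near (stepE i) q _.
- rewrite -(tangent_derive1 xi (diff_stage_U i)).
  rewrite (tangent_near xi _ (diff_stage_p i))//.
  by near=> q; have [//|_ _ -> _ _] := near (stepE i) q _.
- move=> x; have dh := SN_differentiableZ 2^-1 dQU.
  rewrite (tangent_near (G := Sc i iv) xi _ (SN_differentiableD dh dUp)); last first.
    by near=> q; apply/funext => y; have [//|_ _ _ -> _] := near (stepE i) q _.
  rewrite (tangentD _ _ dh dUp) (tangentZ _ _ _ dQU).
  by rewrite (tangent_PNM _ _ (diff_stage_U i) (diff_stage_p i)) addrK.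
- move=> x; have dU := diff_stage_U i; have dp := diff_stage_p i.
  have dw := diff_stage_w i.
  (* The equation is solved for the derivative of v and arranged as a right-nested sum, so that
     linearity of the tangent applies term by term. *)
  have d1 := SN_differentiableZ 2^-1 dQphi.
  have d2 := SN_differentiableZ (- 2^-1) dQp.
  have d3 := SN_differentiableZ (3 / 2) dUU.
  have d4 := SN_differentiableZ 2^-1 dpp.
  have d34 := SN_differentiableD d3 d4.
  have d5 := SN_differentiableD dw d34.
  have d6 := SN_differentiableD d2 d5.
  rewrite -(tangent_derive1 xi (diff_stage_v i)).
  rewrite (tangent_near (G := fun q => derive1 (component (Zs q i) iv)) xi _
    (SN_differentiableD d1 d6)); last first.
    near=> q; apply/funext => y; have [//|_ _ _ _ h] := near (stepE i) q _.
    have shift (p1 p2 r k1 k2 k3 : R) : 2^-1 * p1 - 2^-1 * p2 - r = - k1 - k2 - k3 ->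
        2^-1 * p1 + (- 2^-1 * p2 + (k1 + (k2 + k3))) = r.
      by move=> e; rewrite -[r](subKr (2^-1 * p1 - 2^-1 * p2)) e; ring.
    exact: shift (h y).
  rewrite (tangentD _ _ d1 d6) (tangentD _ _ d2 d5) (tangentD _ _ dw d34)
    (tangentD _ _ d3 d4).
  rewrite (tangentZ _ _ _ dQphi) (tangentZ _ _ _ dQp) (tangentZ _ _ _ dUU)
    (tangentZ _ _ _ dpp).
  rewrite (tangent_PNM _ _ dU dU) (tangent_PNM _ _ dp dp).
  do !match goal with |- context [PN ?f x] => generalize (PN f x) => ? end.
  do !match goal with |- context [tangent q0 ?f xi x] =>
    generalize (tangent q0 f xi x) => ? end.
  by ring.
Unshelve. all: by end_near. Qed.

Lemma tangent_stage i r xi x : SNd q0 (Zc r) -> (forall j, SNd q0 (Sc j r)) ->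
  t (Sc i r) xi x = t (Zc r) xi x + tau * \sum_j A i j * t (Qc j r) xi x.
Proof.
move=> dZ dS; have dQr j := diff_stage_derivative j dZ dS.
have dsum := SN_differentiable_sum (index_enum _) (A i) dQr.
have dts := SN_differentiableZ tau dsum.
rewrite -(tangent_sum (index_enum _) (A i) _ _ dQr) -(tangentZ _ _ _ dsum).
rewrite -(tangentD _ _ dZ dts).
rewrite (tangent_near xi _ (SN_differentiableD dZ dts))//.
near=> q; apply/funext => y; have [//|[_ h _ _ _] _] := near step q _.
rewrite /component h !mxE summxE; congr (_ + _ * _); apply: eq_bigr => j _.
by rewrite !mxE.
Unshelve. all: by end_near. Qed.

(** In contrast to [SN_differentiable_next], nothing is asked of the noise, so this also covers the
    last step. *)
Lemma tangent_next r xi x : SNd q0 (Zc r) -> (forall j, SNd q0 (Sc j r)) ->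
  t (fun q => component (Z' q) r) xi x =
  t (Zc r) xi x + tau * \sum_j bw j * t (Qc j r) xi x.
Proof.
move=> dZ dS; have dQr j := diff_stage_derivative j dZ dS.
have dsum := SN_differentiable_sum (index_enum _) bw dQr.
have dts := SN_differentiableZ tau dsum.
rewrite -(tangent_sum (index_enum _) bw _ _ dQr) -(tangentZ _ _ _ dsum).
rewrite -(tangentD _ _ dZ dts).
rewrite (tangent_add_cst (h := component noise r) xi _ (SN_differentiableD dZ dts))//.
near=> q; move=> y; have [//|[_ _ _ _ h] _] := near step q _.
rewrite /component h !mxE summxE; congr (_ + _ * _ + _); apply: eq_bigr => j _.
by rewrite !mxE.
Unshelve. all: by end_near. Qed.

Lemma in_span_mform (XU Xphi Xp YU Yphi Yp : R -> R) :
  in_span a b N XU -> in_span a b N Xphi -> in_span a b N Xp ->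
  in_span a b N YU -> in_span a b N Yphi -> in_span a b N Yp ->
  continuous (fun x => mform (XU x) (Xphi x) (Xp x) (YU x) (Yphi x) (Yp x)).
Proof.
move=> /in_span_continuous c1 /in_span_continuous c2 /in_span_continuous c3.
move=> /in_span_continuous c4 /in_span_continuous c5 /in_span_continuous c6.
rewrite /mform.
have cM (f h : R -> R) : continuous f -> continuous h ->
    continuous (fun x => - (f x * h x)).
  move=> cf ch; under eq_fun do rewrite -mulN1r.
  by apply: continuous_fun_scale; exact: continuous_fun_mul.
apply: continuous_fun_scale; apply: continuous_fun_add; last exact: continuous_fun_mul.
apply: continuous_fun_add; last exact: cM.
by apply: continuous_fun_add; [exact: continuous_fun_mul|exact: cM].
Qed.

Lemma SN_differentiable_next r : SNd q0 (Zc r) -> (forall j, SNd q0 (Sc j r)) ->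
  in_span a b N (component noise r) -> SNd q0 (fun q => component (Z' q) r).
Proof.
move=> dZ dS [n nE]; have dQr j := diff_stage_derivative j dZ dS.
have dsum := SN_differentiable_sum (index_enum _) bw dQr.
have dZ' := SN_differentiableD dZ (SN_differentiableZ tau dsum).
apply: SN_differentiable_near (SN_differentiableD dZ' (SN_differentiable_cst q0 nE)).
near=> q; apply/funext => y; have [//|[_ _ _ _ h] _] := near step q _.
rewrite /component h !mxE summxE; congr (_ + _ * _ + _); apply: eq_bigr => j _.
by rewrite !mxE.
Unshelve. all: by end_near. Qed.

Lemma rk_step_symplectic xi eta :
  OmegaN a b Z' q0 xi eta - OmegaN a b Z q0 xi eta
  + tau * \sum_i bw i *
      I (fun x => derive1 (fun y => KN (fun q => Zs q i) q0 y xi eta) x) = 0.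
Proof.
have sZ r h : SNd q0 (Zc r) -> in_span a b N (t (Zc r) h) by exact: in_span_tangent.
have sS i r h : SNd q0 (Sc i r) -> in_span a b N (t (Sc i r) h) by exact: in_span_tangent.
have sQ i r h : SNd q0 (Zc r) -> (forall j, SNd q0 (Sc j r)) ->
    in_span a b N (t (Qc i r) h).
  by move=> dZ dS; apply: in_span_tangent; exact: diff_stage_derivative.
pose f x := mform (t (Zc iU) xi x) (t (Zc iphi) xi x) (t (Zc ip) xi x)
                  (t (Zc iU) eta x) (t (Zc iphi) eta x) (t (Zc ip) eta x).
pose G i x := mform (t (Qc i iU) xi x) (t (Qc i iphi) xi x) (t (Qc i ip) xi x)
    (t (Sc i iU) eta x) (t (Sc i iphi) eta x) (t (Sc i ip) eta x)
  + mform (t (Sc i iU) xi x) (t (Sc i iphi) xi x) (t (Sc i ip) xi x)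
    (t (Qc i iU) eta x) (t (Qc i iphi) eta x) (t (Qc i ip) eta x).
have cf : continuous f by apply: in_span_mform; exact: sZ.
have cG i : continuous (G i).
  have dU := diff_stage_U; have dphi := diff_stage_phi.
  have dp := diff_stage_p.
  by apply: continuous_fun_add; apply: in_span_mform; (exact: sQ || exact: sS).
have cbG i : continuous (fun x => bw i * G i x) by exact: continuous_fun_scale.
(* The integrand of the new form, written through the old state and the stages: its continuity is
   visible here without knowing that the new state lies in [S_N]. *)
pose f' x := f x + tau * \sum_i bw i * G i x.
have f'E : f' = fun x => mform
    (t (fun q => component (Z' q) iU) xi x) (t (fun q => component (Z' q) iphi) xi x)
    (t (fun q => component (Z' q) ip) xi x)
    (t (fun q => component (Z' q) iU) eta x) (t (fun q => component (Z' q) iphi) eta x)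
    (t (fun q => component (Z' q) ip) eta x).
  apply/funext => x.
  rewrite !(tangent_next _ _ dZU diff_stage_U).
  rewrite !(tangent_next _ _ dZphi diff_stage_phi) !(tangent_next _ _ dZp diff_stage_p).
  have sU h j := tangent_stage j h x dZU diff_stage_U.
  have sphi h j := tangent_stage j h x dZphi diff_stage_phi.
  have sp h j := tangent_stage j h x dZp diff_stage_p.
  exact/esym/(symplectic_rk_mform symp (sU xi) (sphi xi) (sp xi) (sU eta) (sphi eta) (sp eta)).
have csum : continuous (fun x => \sum_i bw i * G i x).
  exact: continuous_fun_sum.
have cf' : continuous f'.
  by apply: continuous_fun_add => //; exact: continuous_fun_scale.
have -> : OmegaN a b Z q0 xi eta = I f by exact: (OmegaN_mform cf).
have -> : OmegaN a b Z' q0 xi eta = I f'.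
  by rewrite f'E; apply: OmegaN_mform; rewrite f'E in cf'.
have -> : I f' = I f + tau * \sum_i bw i * I (G i).
  rewrite integral_TD//; last exact: continuous_fun_scale.
  rewrite integral_TZ// integral_T_sum//.
  by congr (_ + _ * _); apply: eq_bigr => i _; exact: integral_TZ.
rewrite [_ + _ - _]addrC addrA addNr add0r -mulrDr -big_split/=.
rewrite big1 ?mulr0// => i _; rewrite -mulrDr KN_kform.
have tU h := sS _ _ h (diff_stage_U i); have tphi h := sS _ _ h (diff_stage_phi i).
have tw h := sS _ _ h (diff_stage_w i); have tv h := sS _ _ h (diff_stage_v i).
have tp h := sS _ _ h (diff_stage_p i).
have [cn n0] := linear_stage_identity ab (in_span_at (diff_stage_U i))
  (in_span_at (diff_stage_p i)) (tU xi) (tphi xi) (tw xi) (tv xi) (tp xi)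
  (tU eta) (tphi eta) (tw eta) (tv eta) (tp eta)
  (linear_stage_tangent i xi) (linear_stage_tangent i eta).
set k := kform _ _ _ _ _ _ _ _ in cn n0 *.
rewrite (_ : I (derive1 k) = - I (G i)) ?subrr ?mulr0//.
(* Continuity is at hand for the sum of [G i] and [derive1 k], so [derive1 k] is integrated as that
   sum minus [G i]. *)
transitivity (I (fun x => -1 * G i x + (G i x + derive1 k x))).
  by congr integral_T; apply/funext => x; rewrite mulN1r addKr.
by rewrite integral_TD ?n0 ?addr0 ?integral_TZ ?mulN1r//; exact: continuous_fun_scale.
Qed.

End Families.
End OneStep.

(** * Induction along the trajectory *)

Section Trajectory.
Context {R : realType} (a b : R) (N : nat).
Context (ab : a < b).
Local Notation SNf := (@SN_fun R a b N).
Local Notation SNc := (SN_coord a b N).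
Local Notation V := 'rV[R]_(N + N).
Context (s : nat) (A : 'M[R]_s) (bw : 'I_s -> R) (tau : R).
Context (symp : forall i j, bw i * A i j + bw j * A j i = bw i * bw j).
Context (sumb : \sum_i bw i = 1).
Context (hA : A \in unitmx).
Context (tau0 : tau != 0).

Lemma local_stage_solution_differentiable (q : V) (g : V -> 'M[R]_(s, N + N)) :
  local_stage_solution a b A tau q g -> differentiable g q.
Proof. by move=> [X [Y [/nbhs_singleton Xq _ dg _]]]; exact: dg. Qed.

Lemma init_state_SN_differentiable (q0 : V) (Z : V -> @state R) :
  (\forall q \near q0, Z q = init_state a b N (SNf q) /\
    forall r, in_span a b N (component (Z q) r)) ->
  forall r, r \in [:: iU; iphi; ip] ->
  SN_differentiable a b q0 (fun q => component (Z q) r).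
Proof.
move=> init.
have dU : SN_differentiable a b q0 (fun q : V => SNf q).
  by exists id => //; near=> q.
have E q : component (init_state a b N (SNf q)) iU = SNf q.
  by apply/funext => x; rewrite /component mxE.
have Ep q : component (init_state a b N (SNf q)) ip = derive1 (SNf q).
  by apply/funext => x; rewrite /component mxE.
have Ephi q : component (init_state a b N (SNf q)) iphi = dx_inv a b (SNf q).
  by apply/funext => x; rewrite /component mxE.
move=> r; rewrite !inE => /or3P[] /eqP ->.
- apply: SN_differentiable_near dU.
  by near=> q; have [//|->] := near init q _.
- exists (fun q => q *m antideriv_mx a b N).
    by apply: differentiable_mulmxr.
  near=> q; have [//|-> /(_ iphi)[d]] := near init q _.
  by rewrite Ephi => /(dx_inv_SN_fun ab).
- apply: SN_differentiable_near (SN_differentiable_derive1 dU).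
  by near=> q; have [//|->] := near init q _.
Unshelve. all: by end_near. Qed.

Theorem rk_trajectory_symplectic (Nt : nat) (noise : nat -> @state R) (q0 : V)
    (Z : V -> nat -> @state R) (Zs Qs : V -> nat -> 'I_s -> @state R) :
  rk_trajectory a b A bw tau Nt noise q0 Z Zs Qs ->
  forall k, (k < Nt)%N -> forall xi eta : V,
    OmegaN a b (fun q => Z q k.+1) q0 xi eta - OmegaN a b (fun q => Z q k) q0 xi eta
    + tau * \sum_i bw i * integral_T a b (fun x =>
        derive1 (fun y => KN (fun q => Zs q k i) q0 y xi eta) x) = 0.
Proof.
move=> [g [dg traj]].
(* Without stages the weights would sum to 0. A stage is needed to read off that states lie in
   [S_N]. *)
have s_gt0 : (0 < s)%N.
  rewrite lt0n; apply/eqP => s0; have := sumb; rewrite big1 => [/esym/eqP|j _].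
    by rewrite oner_eq0.
  by have := leq_trans (ltn_ord j) (eq_leq s0).
pose i := Ordinal s_gt0.
have step k : (k < Nt)%N -> \forall q \near q0,
    rk_step a b N A bw tau (noise k) (Z q k) (Zs q k) (Qs q k) (Z q k.+1) /\
    forall i, component (Zs q k i) iU =
      SNf (row i (g k (SNc (component (Z q k) iU)))).
  by move=> kN; apply: filterS traj => q [_]; exact.
(* The range stops before [Nt] because membership of state [k] in [S_N] is read off the stages of
   step [k]. *)
have dZ k : (k < Nt)%N -> forall r, r \in [:: iU; iphi; ip] ->
    SN_differentiable a b q0 (fun q => component (Z q k) r).
  elim: k => [|k IH] kN r hr.
    apply: init_state_SN_differentiable hr.
    near=> q; split; first by have [] := near traj q _.
    by move=> r'; have [//|h _] := near (step _ kN) q _; exact: rk_step_in_span i r' h.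
  have kN' := ltnW kN; have {}IH := IH kN'.
  have dgk := local_stage_solution_differentiable (dg _ kN').
  have dSU_k := diff_stage_U ab (step _ kN') dgk (IH iU isT).
  have dSphi_k := diff_stage_phi ab (step _ kN') dgk (IH iU isT).
  have dSp_k := diff_stage_p ab (step _ kN') dgk (IH iU isT).
  apply: (SN_differentiable_next hA tau0 (step _ kN')) => //.
  - exact: IH.
  - move: hr; rewrite !inE => /or3P[] /eqP ->.
    + exact: dSU_k.
    + exact: dSphi_k.
    + exact: dSp_k.
  (* The noise is the same for all [q], so looking at the two consecutive steps at [q0] is
     enough. *)
  - have [h _] := nbhs_singleton (step _ kN'); have [h' _] := nbhs_singleton (step _ kN).
    exact: rk_step_noise_in_span i r h (rk_step_in_span i r h').
move=> k kN xi eta.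
by apply: (rk_step_symplectic ab symp hA tau0 (step _ kN)
  (local_stage_solution_differentiable (dg _ kN))); exact: dZ.
Unshelve. all: by end_near. Qed.

End Trajectory.

Theorem theorem3p1
  (R : realType) (a b : R) (hab : a < b)
  (sigma : R) (hsigma : 5 / 2 < sigma)
  (d : measure_display) (Omega : measurableType d) (P : probability Omega R)
  (e : nat -> R -> R) (beta : nat -> R -> Omega -> R)
  (hW : cylindrical_wiener P a b e beta)
  (Phi : (R -> R) -> R -> R) (hPhi : hilbert_schmidt a b (sigma - 2) Phi)
  (u0 : R -> R) (hu0 : H0 a b sigma u0)
  (N : nat) (hN : (1 <= N)%N)
  (T : R) (hT : 0 < T) (Nt : nat) (hNt : (1 <= Nt)%N)
  (tau : R) (htau : tau = T / Nt%:R)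
  (s : nat) (A : 'M[R]_s) (bw : 'I_s -> R)
  (hsymp : forall i j, bw i * A i j + bw j * A j i = bw i * bw j)
  (hsum : \sum_i bw i = 1)
  (hA : A \in unitmx)
  (q0 : 'rV[R]_(N + N)) (hq0 : SN_fun a b q0 = PN a b N u0)
  (Z : Omega -> 'rV[R]_(N + N) -> nat -> state)
  (Zs Qs : Omega -> 'rV[R]_(N + N) -> nat -> 'I_s -> state) :
  {ae P, forall w : Omega,
    rk_trajectory a b A bw tau Nt
      (fun k => noise_increment a b N Phi e beta (k%:R * tau) (k.+1%:R * tau) w)
      q0 (Z w) (Zs w) (Qs w) ->
    forall k, (k < Nt)%N -> forall xi eta : 'rV[R]_(N + N),
      OmegaN a b (fun q => Z w q k.+1) q0 xi eta
      - OmegaN a b (fun q => Z w q k) q0 xi eta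
      + tau * \sum_i bw i *
          integral_T a b (fun x =>
            derive1 (fun y => KN (fun q => Zs w q k i) q0 y xi eta) x) = 0}.
Proof.
(* The argument is pathwise and gives the identity for every realization. *)
apply: aeW => w.
apply: rk_trajectory_symplectic => //.
(* Recovering the stage derivatives divides by [tau]. *)
by rewrite htau mulf_neq0// ?invr_neq0 ?pnatr_eq0 -?lt0n// gt_eqF.
Qed.
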